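(* Let $n\in\mathbb{N}$, $\boldsymbol{y}=(y_1,\dots,y_n)^T\in\mathbb{R}^n$, $V>0$ and $a,b>0$, and consider the Markov transition density on $\mathbb{R}^n$ $$k_2(\boldsymbol{\theta}'\mid\boldsymbol{\theta})=\int_0^\infty\int_{\mathbb{R}}\pi(\boldsymbol{\theta}'\mid\mu,A,\boldsymbol{y})\,\pi(\mu,A\mid\boldsymbol{\theta},\boldsymbol{y})\,d\mu\,dA .$$ If $n\ge 3$, then the Markov operator on $L^2(\Pi)$ defined by $k_2$ is trace-class.
   Context: Model. $y_i=\theta_i+e_i$, $i=1,\dots,n$, where the $\theta_i$ are iid $\mathrm{N}(\mu,A)$, the $e_i$ are iid $\mathrm{N}(0,V)$ independent of the $\theta_i$, and $V>0$ is known. The prior is $\pi(\mu)\propto1$ (flat on $\mathbb{R}$) and, independently, $A\sim\mathrm{IG}(a,b)$, where $\mathrm{IG}(a,b)$ has density proportional to $x^{-a-1}e^{-b/x}$ on $(0,\infty)$. The posterior density on $\mathbb{R}^n\times\mathbb{R}\times(0,\infty)$ is $$\pi(\boldsymbol{\theta},\mu,A\mid\boldsymbol{y})\propto A^{-a-1-\frac n2}e^{-b/A}\exp\Big\{-\frac{1}{2A}\sum_{i=1}^n(\theta_i-\mu)^2-\frac1{2V}\sum_{i=1}^n(y_i-\theta_i)^2\Big\},$$ where $\boldsymbol{\theta}=(\theta_1,\dots,\theta_n)^T$. Conditional densities, with $\bar\theta=\frac1n\sum_i\theta_i$: $\pi(\mu,A\mid\boldsymbol{\theta},\boldsymbol{y})$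 is the joint density of $(\mu,A)$ when $A\sim\mathrm{IG}\big(a+\frac{n-1}2,\ b+\frac12\sum_{i=1}^n(\theta_i-\bar\theta)^2\big)$ and, given $A$, $\mu\sim\mathrm{N}(\bar\theta,A/n)$; and under $\pi(\boldsymbol{\theta}\mid\mu,A,\boldsymbol{y})$ the $\theta_i$ are independent with $\theta_i\sim\mathrm{N}\big(\frac{V\mu+Ay_i}{A+V},\ \frac{AV}{A+V}\big)$. (Normal distributions are written as mean, variance.) $\Pi$ is the marginal posterior distribution of $\boldsymbol{\theta}$, with density $\pi(\boldsymbol{\theta}\mid\boldsymbol{y})=\int_0^\infty\int_{\mathbb{R}}\pi(\boldsymbol{\theta},\mu,A\mid\boldsymbol{y})\,d\mu\,dA$; it is stationary for $k_2$. The Markov operator defined by $k_2$ is $K:L^2(\Pi)\to L^2(\Pi)$, $(Kf)(\boldsymbol{\theta})=\int_{\mathbb{R}^n}f(\boldsymbol{\theta}')\,k_2(\boldsymbol{\theta}'\mid\boldsymbol{\theta})\,d\boldsymbol{\theta}'$. A Markov operator is called trace-class if it is self-adjoint, positive and compact, and its eigenvalues (counted with multiplicity) are summable. *)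

(* Defs.v *)
From HB Require Import structures.
From mathcomp Require Import all_boot all_order all_algebra.
From mathcomp Require Import all_classical all_reals all_analysis.
From mathcomp Require Import measurable_realfun.

Set Implicit Arguments.
Unset Strict Implicit.
Unset Printing Implicit Defensive.
Import Order.TTheory GRing.Theory Num.Theory.
Import numFieldNormedType.Exports.

Local Open Scope classical_set_scope.
Local Open Scope ring_scope.

(* [measurableTypeR R] is [R] with the Borel sigma-algebra on which
   [lebesgue_measure] is defined. *)
Notation euclidean R n := (n.-tuple (measurableTypeR R)).

Section density_measure.
Context d (T : measurableType d) (R : realType).
Variables (mu : {measure set T -> \bar R}) (g : T -> \bar R).
Local Open Scope ereal_scope.
Hypothesis g0 : forall x, 0 <= g x.
Hypothesis mg : measurable_fun [set: T] g.

Definition density_measure of (forall x, 0 <= g x) & measurable_fun [set: T] g :=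
  fun A : set T => \int[mu]_(x in A) g x.

Local Notation nu := (density_measure g0 mg).

Let nu0 : nu set0 = 0.
Proof. exact: integral_set0. Qed.

Let nu_ge0 A : 0 <= nu A.
Proof. by apply: integral_ge0 => x _; exact: g0. Qed.

Let nu_sigma_additive : semi_sigma_additive nu.
Proof.
move=> F mF tF mUF; rewrite /density_measure ge0_integral_bigcup//.
  by apply: is_cvg_ereal_nneg_natsum_cond => k _ _; apply: integral_ge0.
exact: measurable_funTS.
Qed.

HB.instance Definition _ :=
  isMeasure.Build _ _ _ nu nu0 nu_ge0 nu_sigma_additive.

End density_measure.

Section lebesgue_measure_n.
Context {R : realType}.
Local Open Scope ereal_scope.

Definition cons_tuple_pair n (p : measurableTypeR R * euclidean R n) :
  euclidean R n.+1 := [tuple of p.1 :: p.2].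

Lemma measurable_cons_tuple_pair n :
  measurable_fun [set: measurableTypeR R * euclidean R n] (@cons_tuple_pair n).
Proof. exact: measurable_cons. Qed.

Definition behead_tuple_pair n (t : euclidean R n.+1) :
  measurableTypeR R * euclidean R n := (tnth t ord0, [tuple of behead t]).

Lemma measurable_behead_tuple_pair n :
  measurable_fun [set: euclidean R n.+1] (@behead_tuple_pair n).
Proof.
apply: measurable_fun_pair => /=.
  by apply: measurable_tnth.
exact: measurable_behead.
Qed.

Lemma cons_tuple_pairK n : cancel (@cons_tuple_pair n) (@behead_tuple_pair n).
Proof.
by move=> [x t]; rewrite /behead_tuple_pair; congr pair; exact/val_inj.
Qed.

Section step.
Variable (n : nat) (m : {sigma_finite_measure set (euclidean R n) -> \bar R}).

Definition lebesgue_cons : set (euclidean R n.+1) -> \bar R :=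
  pushforward (@lebesgue_measure R \x m) (@cons_tuple_pair n).

Let lebesgue_cons0 : lebesgue_cons set0 = 0.
Proof. by rewrite /lebesgue_cons /pushforward preimage_set0 measure0. Qed.

Let lebesgue_cons_ge0 A : 0 <= lebesgue_cons A.
Proof. by rewrite /lebesgue_cons /pushforward measure_ge0. Qed.

Let mpre (A : set (euclidean R n.+1)) : measurable A ->
  measurable (@cons_tuple_pair n @^-1` A).
Proof. by move=> mA; rewrite -[X in measurable X]setTI; exact: measurable_cons_tuple_pair. Qed.

Let lebesgue_cons_sigma_additive : semi_sigma_additive lebesgue_cons.
Proof.
move=> F mF tF mUF; rewrite /lebesgue_cons /pushforward preimage_bigcup.
apply: measure_semi_sigma_additive.
- by move=> k; exact: mpre.
- apply/trivIsetP => /= i j _ _ ij; rewrite -preimage_setI.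
  by move/trivIsetP : tF => /(_ _ _ _ _ ij) ->//; rewrite preimage_set0.
- by rewrite -preimage_bigcup; exact: mpre.
Qed.

HB.instance Definition _ := isMeasure.Build _ _ _ lebesgue_cons
  lebesgue_cons0 lebesgue_cons_ge0 lebesgue_cons_sigma_additive.

Let lebesgue_cons_sigma_finite : sigma_finite [set: _] lebesgue_cons.
Proof.
have /sigma_finiteP[F [TF ndF Foo]] := sigma_finiteT (@lebesgue_measure R).
have /sigma_finiteP[G [TG ndG Goo]] := sigma_finiteT m.
exists (fun k => @behead_tuple_pair n @^-1` (F k `*` G k)).
  apply/seteqP; split => // t _ /=.
  have [i _ Fi] : (\bigcup_i F i) (tnth t ord0) by rewrite -TF.
  have [j _ Gj] : (\bigcup_i G i) [tuple of behead t] by rewrite -TG.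
  exists (maxn i j) => //; split => /=.
    by move: Fi; exact/subsetPset/ndF/leq_maxl.
  by move: Gj; exact/subsetPset/ndG/leq_maxr.
move=> k; have [mF Fk] := Foo k; have [mG Gk] := Goo k; split.
  rewrite -[X in measurable X]setTI; apply: measurable_behead_tuple_pair => //.
  exact: measurableX.
rewrite /lebesgue_cons /pushforward -comp_preimage.
rewrite (_ : _ \o _ = id); last first.
  by apply/funext => p /=; exact: cons_tuple_pairK.
by rewrite preimage_id product_measure1E// lte_mul_pinfty// ge0_fin_numE.
Qed.

HB.instance Definition _ := Measure_isSigmaFinite.Build _ _ _ lebesgue_cons
  lebesgue_cons_sigma_finite.

End step.

Section base.

Let point : euclidean R 0 := [tuple].

Let dirac_sigma_finite : sigma_finite [set: _] (@dirac _ _ point R).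
Proof.
apply: fin_num_fun_sigma_finite; first by rewrite measure0.
by move=> A _; rewrite diracE.
Qed.

Definition lebesgue_0 : set (euclidean R 0) -> \bar R := dirac point.
HB.instance Definition _ := Measure.on lebesgue_0.
HB.instance Definition _ := Measure_isSigmaFinite.Build _ _ _ lebesgue_0
  dirac_sigma_finite.

End base.

Fixpoint lebesgue_measure_n n :
    {sigma_finite_measure set (euclidean R n) -> \bar R} :=
  match n with
  | 0 => lebesgue_0
  | k.+1 => lebesgue_cons (lebesgue_measure_n k)
  end.

Lemma lebesgue_measure_n_box n (A : 'I_n -> set R) :
  (forall i, measurable (A i)) ->
  lebesgue_measure_n n [set t | forall i, A i (tnth t i)] =
  \prod_(i < n) lebesgue_measure (A i).
Proof.
elim: n A => [|n IH] A mA.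
  by rewrite big_ord0 /= /lebesgue_0 diracE mem_set//= => -[].
rewrite big_ord_recl -IH//= /lebesgue_cons /pushforward.
rewrite -product_measure1E//; first congr (_ _).
- apply/seteqP; split=> [[x t] /= At|[x t] /= [Ax At] i].
    split; first by have := At ord0.
    by move=> i; have := At (lift ord0 i); rewrite tnthS.
  case: (unliftP ord0 i) => [j|] ->; last by [].
  by rewrite tnthS.
- exact: mA.
- rewrite (_ : [set t | _] = \bigcap_(i in [set: 'I_n])
      ((fun t : euclidean R n => tnth t i) @^-1` A (lift ord0 i))).
    apply: fin_bigcap_measurable => [|i _]; first exact: finite_finset.
    rewrite -[X in measurable X]setTI.
    by apply: measurable_tnth => //; exact: mA.
  by apply/seteqP; split => t /= At i; [move=> _|]; exact: At.
Qed.

End lebesgue_measure_n.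

(* Operators on L^2(mu) are represented by maps on functions, acting on
   representatives of classes modulo mu-a.e. equality. *)
Section L2_operators.
Context d (T : measurableType d) (R : realType).
Variable mu : {measure set T -> \bar R}.
Implicit Types (K : (T -> R) -> T -> R) (f g : T -> R) (l : R).

Definition L2dot f g : R := \int[mu]_x (f x * g x).

Definition L2_operator K :=
  [/\ forall f, f \in Lfun mu 2%:E -> K f \in Lfun mu 2%:E,
      forall f g, f \in Lfun mu 2%:E -> g \in Lfun mu 2%:E ->
        f = g %[ae mu] -> K f = K g %[ae mu] &
      forall (c : R) f g, f \in Lfun mu 2%:E -> g \in Lfun mu 2%:E ->
        K (fun x => c * f x + g x) = (fun x => c * K f x + K g x) %[ae mu]].

Definition L2_self_adjoint K :=
  forall f g, f \in Lfun mu 2%:E -> g \in Lfun mu 2%:E ->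
    L2dot (K f) g = L2dot f (K g).

Definition L2_positive K :=
  forall f, f \in Lfun mu 2%:E -> 0 <= L2dot (K f) f.

Definition L2_compact K :=
  forall u : nat -> T -> R,
    (forall i, u i \in Lfun mu 2%:E) ->
    (exists M : R, forall i, ('N[mu]_2%:E[EFin \o u i] <= M%:E)%E) ->
    exists (phi : nat -> nat) (g : T -> R),
      [/\ {homo phi : i j / (i < j)%N >-> (i < j)%N},
          g \in Lfun mu 2%:E &
          'N[mu]_2%:E[EFin \o (K (u (phi i)) \- g)%R]%E @[i --> \oo] --> 0%E].

Definition L2_eigenspace K l : set (T -> R) :=
  [set f | f \in Lfun mu 2%:E /\ K f = (fun x => l * f x) %[ae mu]].

Definition L2_eigenvalues K : set R :=
  [set l | exists2 f, L2_eigenspace K l f & ~ f = cst 0 %[ae mu]].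

Definition L2_free m (e : 'I_m -> T -> R) :=
  forall c : 'I_m -> R,
    (fun x => \sum_(i < m) c i * e i x) = cst 0 %[ae mu] ->
    forall i, c i = 0.

(* Dimension, possibly +oo, of the eigenspace modulo a.e. equality. *)
Definition L2_multiplicity K l : \bar R :=
  ereal_sup [set m%:R%:E | m in
    [set m : nat | exists2 e : 'I_m -> T -> R,
      (forall i, L2_eigenspace K l (e i)) & L2_free e]].

(* In \bar R, 0 * +oo = 0: the eigenvalue 0 contributes nothing to the sum,
   whatever its multiplicity. *)
Record trace_class K : Prop := TraceClass {
  trace_class_operator : L2_operator K ;
  trace_class_self_adjoint : L2_self_adjoint K ;
  trace_class_positive : L2_positive K ;
  trace_class_compact : L2_compact K ;
  trace_class_summable :
    summable (L2_eigenvalues K) (fun l => l%:E * L2_multiplicity K l)%E }.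

End L2_operators.

Section kernel_operator.
Context d (T : measurableType d) (R : realType).
Variables (lam : {measure set T -> \bar R}) (k : T -> T -> \bar R).

(* [k x' x] is the density at [x'], with respect to [lam], of the transition
   from [x]. *)
Definition kernel_operator (f : T -> R) (x : T) : R :=
  fine (\int[lam]_x' ((f x')%:E * k x' x))%E.

Definition kernel_operator_defined (mu : {measure set T -> \bar R}) :=
  forall f : T -> R, f \in Lfun mu 2%:E ->
    {ae mu, forall x, lam.-integrable setT (fun x' => (f x')%:E * k x' x)%E}.

End kernel_operator.

Section inverse_gamma.
Context {R : realType}.

Definition inverse_gamma_fun (a b x : R) : R := x `^ (- a - 1) * expR (- b / x).

Definition inverse_gamma_pdf (a b x : R) : R :=
  if 0 < x then
    inverse_gamma_fun a b x /
    \int[lebesgue_measure]_(t in `]0, +oo[) inverse_gamma_fun a b t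
  else 0.

(* [normal_pdf] is parameterized by the standard deviation. *)
Definition normal_var_pdf (m v x : R) : R := normal_pdf m (Num.sqrt v) x.

End inverse_gamma.

Section hierarchical_model.
Context {R : realType} (n : nat).
Variables (y : n.-tuple R) (V a b : R).
Implicit Types (theta : euclidean R n) (m A : R).

Definition tuple_mean theta : R := n%:R^-1 * \sum_(i < n) tnth theta i.

Definition unnormalized_posterior theta m A : R :=
  A `^ (- a - 1 - n%:R / 2) * expR (- b / A) *
  expR (- (2 * A)^-1 * (\sum_(i < n) (tnth theta i - m) ^+ 2)
        - (2 * V)^-1 * (\sum_(i < n) (tnth y i - tnth theta i) ^+ 2)).

Definition unnormalized_marginal theta : \bar R :=
  (\int[lebesgue_measure]_(A in `]0%R, +oo[) \int[lebesgue_measure]_m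
     (unnormalized_posterior theta m A)%:E)%E.

(* Finite and positive when V, a, b > 0 and n > 0, so that [fine] below is
   harmless. *)
Definition posterior_constant : \bar R :=
  (\int[lebesgue_measure_n n]_theta unnormalized_marginal theta)%E.

Definition marginal_posterior_density theta : \bar R :=
  (((fine posterior_constant)^-1)%:E * unnormalized_marginal theta)%E.

Lemma unnormalized_marginal_ge0 theta : (0 <= unnormalized_marginal theta)%E.
Proof.
apply: integral_ge0 => A _; apply: integral_ge0 => m _.
by rewrite lee_fin !mulr_ge0 ?powR_ge0 ?expR_ge0.
Qed.

Lemma marginal_posterior_density_ge0 theta :
  (0 <= marginal_posterior_density theta)%E.
Proof.
rewrite mule_ge0 ?unnormalized_marginal_ge0// lee_fin invr_ge0 fine_ge0//.
by apply: integral_ge0 => t _; exact: unnormalized_marginal_ge0.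
Qed.

Lemma measurable_unnormalized_marginal :
  measurable_fun [set: euclidean R n] unnormalized_marginal.
Proof.
pose f (p : (euclidean R n * measurableTypeR R) * measurableTypeR R) : \bar R :=
  (p.1.2 `^ (- a - 1 - n%:R / 2) * expR (- b * p.1.2 `^ (-1)) *
   expR (- (2^-1 * p.1.2 `^ (-1)) *
           (\sum_(i < n) (tnth p.1.1 i - p.2) ^+ 2)
        - (2 * V)^-1 * (\sum_(i < n) (tnth y i - tnth p.1.1 i) ^+ 2)))%:E.
have f0 p : (0 <= f p)%E by rewrite lee_fin !mulr_ge0 ?powR_ge0 ?expR_ge0.
have mA : measurable_fun setT (fun p : (euclidean R n * measurableTypeR R)
    * measurableTypeR R => p.1.2 : R).
  exact: (measurableT_comp measurable_snd measurable_fst).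
have mm : measurable_fun setT (fun p : (euclidean R n * measurableTypeR R)
    * measurableTypeR R => p.2 : R) by exact: measurable_snd.
have mt i : measurable_fun setT (fun p : (euclidean R n * measurableTypeR R)
    * measurableTypeR R => tnth p.1.1 i : R).
  apply: (measurableT_comp (measurable_tnth i)).
  exact: (measurableT_comp measurable_fst measurable_fst).
have mf : measurable_fun setT f.
  apply/measurable_EFinP; apply: measurable_funM; first apply: measurable_funM.
  - exact: (measurableT_comp (measurable_powR _) mA).
  - apply: measurableT_comp => //; apply: measurable_funM => //.
    exact: (measurableT_comp (measurable_powR _) mA).
  - apply: measurableT_comp => //; apply: measurable_funB.
      apply: measurable_funM.
        apply: measurableT_comp => //; apply: measurable_funM => //.
        exact: (measurableT_comp (measurable_powR _) mA).
      apply: measurable_sum => i; apply: measurable_funX.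
      exact: measurable_funB.
    apply: measurable_funM => //; apply: measurable_sum => i.
    by apply: measurable_funX; exact: measurable_funB.
pose D : set (measurableTypeR R) := [set` `]0 : R, +oo[%R].
pose F := fubini_F (@lebesgue_measure R) f.
have mF : measurable_fun setT F by exact: measurable_fun_fubini_tonelli_F.
have F0 p : (0 <= F p)%E by apply: integral_ge0.
pose h := F \_ ([set: euclidean R n] `*` D).
have mh : measurable_fun setT h.
  apply/(measurable_restrictT _ _).1 => //; last exact: measurable_funTS.
  by apply: measurableX => //; exact: measurable_itv.
have h0 p : (0 <= h p)%E by rewrite /h patchE; case: ifP.
rewrite (_ : unnormalized_marginal = fubini_F (@lebesgue_measure R) h).
  exact: measurable_fun_fubini_tonelli_F.
apply/funext => t; rewrite /unnormalized_marginal integral_mkcond.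
apply: eq_integral => A _; rewrite /h !patchE in_setX in_setT/=.
case: ifPn => //; rewrite inE/= in_itv/= andbT => A0.
apply: eq_integral => m _; rewrite /f /unnormalized_posterior /=.
by rewrite powR_inv1 ?ltW// invfM.
Qed.

Lemma measurable_marginal_posterior_density :
  measurable_fun [set: euclidean R n] marginal_posterior_density.
Proof. exact: measurable_funeM measurable_unnormalized_marginal. Qed.

Definition marginal_posterior : {measure set (euclidean R n) -> \bar R} :=
  density_measure (lebesgue_measure_n n)
    marginal_posterior_density_ge0 measurable_marginal_posterior_density.

(* pi(mu, A | theta, y) *)
Definition cond_mu_A theta m A : R :=
  inverse_gamma_pdf (a + (n%:R - 1) / 2)
    (b + 2^-1 * \sum_(i < n) (tnth theta i - tuple_mean theta) ^+ 2) A *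
  normal_var_pdf (tuple_mean theta) (A / n%:R) m.

(* pi(theta | mu, A, y) *)
Definition cond_theta m A theta : R :=
  \prod_(i < n) normal_var_pdf ((V * m + A * tnth y i) / (A + V))
    (A * V / (A + V)) (tnth theta i).

Definition k2 theta' theta : \bar R :=
  (\int[lebesgue_measure]_(A in `]0%R, +oo[) \int[lebesgue_measure]_m
     (cond_theta m A theta' * cond_mu_A theta m A)%:E)%E.

End hierarchical_model.

(* Main.v *)
Require Import Defs.
From HB Require Import structures.
From mathcomp Require Import finmap.
From mathcomp Require Import all_boot all_order all_algebra.
From mathcomp Require Import all_classical all_reals all_analysis.
From mathcomp Require Import measurable_realfun ring lra.
Import Order.TTheory GRing.Theory Num.Theory.
Import numFieldNormedType.Exports.
Set Implicit Arguments.
Unset Strict Implicit.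
Unset Printing Implicit Defensive.
Local Open Scope classical_set_scope.
Local Open Scope ring_scope.

(** Why the operator is trace-class.

    Write [z = (A, m)] and let [P] be the operator sending a function of [theta]
    to its conditional expectation given [z]. Each transition of the sampler draws
    [z] given [theta] and then [theta'] given [z], and detailed balance identifies
    its Markov operator with [Pt \o P], where [Pt] is the adjoint of [P]. It is
    therefore self-adjoint and positive, and it is trace-class once [P] is a
    Hilbert-Schmidt operator. The squared Hilbert-Schmidt norm of [P] is the
    integral of [k2 theta theta], so that everything reduces to the finiteness of
    this integral.

    The general part concerns a nonnegative kernel [phi] on a product of two
    sigma-finite spaces, square-integrable for the product measure, and the
    operator with kernel [HS_square], the integral over [z] of
    [phi x' z * phi x z] ([HS_square_trace_class]). Compactness comes from weak
    sequential compactness of bounded sequences ([weak_compactness]) followed by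
    dominated convergence ([HS_operator_compact]). For the eigenvalues, an
    orthonormal family of eigenfunctions [e i] with eigenvalues [l i] satisfies
    [l i = |P (e i)| ^ 2], and Bessel's inequality applied to the sections of
    [phi] bounds the sum of the [l i] by the squared norm of [phi]. Eigenfunctions
    for distinct eigenvalues are orthogonal, so this controls the sum over all
    eigenvalues with multiplicity.

    The diagonal is estimated pointwise in [diagonal_density_le]: the product
    [cond_theta m A theta * cond_mu_A theta m A] is bounded by a constant times
    an inverse gamma density in [A], a normal density in [m] and a product of
    Cauchy densities in [theta]. After completing the squares, the exponent is at
    most a constant minus [b / A], a multiple of [(m - tuple_mean theta) ^+ 2 / A], and
    [decay_rate A] times the squared distance of [theta] to [y]
    ([exponent_le]). The decay in [theta] is lost as [A] tends to [0], but only at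
    the price of powers of [A^-1], which [expR (- b / A)] absorbs. The normalizing
    constant of the inverse gamma density of [A] given [theta] contributes a
    factor polynomial in [theta] ([inverse_gamma_mass_ge]), which the decay in
    [theta] absorbs. For large [A] the integrand behaves as
    [A `^ (- ig_shape - 1)]; since [3 <= n] gives [1 <= ig_shape], it is dominated
    by [(1 + A ^+ 2)^-1]. *)

(** * The inner product of L^2 *)

(** Gives both the Cauchy-Schwarz inequality and, in [weak_cvg_of_gram], the near
    orthogonality of the residual of an almost best approximation. *)
Lemma discriminant_le (R : realFieldType) (a b c : R) :
  (forall t, 0 <= a + 2 * t * b + t ^+ 2 * c) -> b ^+ 2 <= a * c.
Proof.
move=> h; have a0 : 0 <= a by have := h 0; lra.
have [c0|c0|c0] := ltrgtP c 0.
- (* A concave parabola is negative far enough from the origin. *)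
  exfalso; pose s := (a + 1 + `|b| * 2) / - c + 1.
  have sc : s * - c = a + 1 + `|b| * 2 - c.
    by rewrite /s mulrDl mul1r divfK// oppr_eq0 lt_eqF.
  have s1 : 1 <= s.
    by rewrite lerDr divr_ge0 ?oppr_ge0 ?(ltW c0)// !addr_ge0 ?mulr_ge0.
  have := h s; have hb := ler_norm b; have nb := normr_ge0 b.
  have h1 : s * (s * - c) = s * (a + 1 + `|b| * 2 - c) by rewrite sc.
  nra.
- have := h (- b / c); rewrite -(ler_pM2r c0) mul0r.
  have -> : (a + 2 * (- b / c) * b + (- b / c) ^+ 2 * c) * c = a * c - b ^+ 2.
    by field; rewrite gt_eqF.
  by rewrite subr_ge0.
- rewrite c0 mulr0; have [->|b0] := eqVneq b 0; first by rewrite expr0n.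
  have := h (- (a + 1) / (2 * b)); rewrite c0 mulr0 addr0.
  have -> : a + 2 * (- (a + 1) / (2 * b)) * b = -1 by field.
  by lra.
Qed.

Section L2_inner_product.
Context d (T : measurableType d) (R : realType).
Variable mu : {measure set T -> \bar R}.
Local Notation L2 := (Lfun mu 2%:E).
Implicit Types (f g h : T -> R) (c : R).

Lemma Lfun_measurable f p : f \in Lfun mu p -> measurable_fun setT f.
Proof. by rewrite inE => /andP[/[!inE]]. Qed.

Lemma Lfun2P f : f \in L2 <->
  measurable_fun setT f /\ mu.-integrable setT (fun x => (f x ^+ 2)%:E).
Proof.
split=> [fL|[mf fi]].
  by split; [exact: Lfun_measurable fL|exact: Lfun2_integrable_sqr].
rewrite inE; apply/andP; split; rewrite inE//= /finite_norm unlock poweR_lty//.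
move/integrableP : fi => [_]; apply: le_lt_trans.
rewrite le_eqVlt; apply/orP; left; apply/eqP; apply: eq_integral => x _ /=.
by rewrite powR_mulrn// real_normK ?num_real// ger0_norm ?sqr_ge0.
Qed.

Lemma Lfun2_mul_integrable f g : f \in L2 -> g \in L2 ->
  mu.-integrable setT (fun x => (f x * g x)%:E).
Proof. by move=> fL gL; exact/Lfun1_integrable/Lfun2_mul_Lfun1. Qed.

Lemma Lfun2_cst0 : (fun=> 0) \in L2.
Proof.
by apply/Lfun2P; split => //; under eq_fun do rewrite expr0n; exact: integrable0.
Qed.

Lemma Lfun2_lin c f g : f \in L2 -> g \in L2 -> (fun x => c * f x + g x) \in L2.
Proof.
move=> fL gL; have cfL : (fun x => c * f x) \in L2.
  have -> : (fun x => c * f x) = c \o* f by apply/funext => x /=; rewrite mulrC.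
  by apply: Lfun_scale => //; rewrite ler1n.
by have [_] := Lfun_addr_closed mu (@lee1n R 2); apply.
Qed.

Lemma Lfun2_sum (I : finType) (c : I -> R) (e : I -> T -> R) :
  (forall i, e i \in L2) -> (fun x => \sum_i c i * e i x) \in L2.
Proof.
move=> eL; elim: (index_enum I) => [|i s IH].
  by under eq_fun do rewrite big_nil; exact: Lfun2_cst0.
by under eq_fun do rewrite big_cons; exact: Lfun2_lin.
Qed.

Lemma Lfun2_ae_eq f g : f \in L2 -> measurable_fun setT g -> f = g %[ae mu] ->
  g \in L2.
Proof.
move=> /Lfun2P[mf fi] mg fg; apply/Lfun2P; split => //.
apply/integrableP; split; first by apply/measurable_EFinP/measurable_funX.
move/integrableP : fi => [_]; apply: le_lt_trans.
apply: ae_ge0_le_integral => //.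
- by apply: measurableT_comp => //; apply/measurable_EFinP/measurable_funX.
- by apply: measurableT_comp => //; apply/measurable_EFinP/measurable_funX.
by apply: filterS fg => x /= + _ => ->.
Qed.

Lemma L2dotC f g : L2dot mu f g = L2dot mu g f.
Proof. by apply: eq_Rintegral => x _; rewrite mulrC. Qed.

Lemma L2dot_lin c f g h : f \in L2 -> g \in L2 -> h \in L2 ->
  L2dot mu (fun x => c * f x + g x) h = c * L2dot mu f h + L2dot mu g h.
Proof.
move=> fL gL hL; rewrite /L2dot -RintegralZl//; last exact: Lfun2_mul_integrable.
rewrite -RintegralD//; last 2 first.
- have -> : EFin \o (fun x => c * (f x * h x)) =
      fun x => (c%:E * (f x * h x)%:E)%E by apply/funext => x /=; rewrite EFinM.
  exact/integrableZl/Lfun2_mul_integrable.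
- exact: Lfun2_mul_integrable.
by apply: eq_Rintegral => x _; rewrite mulrDl mulrA.
Qed.

Lemma L2dot0l h : L2dot mu (fun=> 0) h = 0.
Proof.
by rewrite /L2dot; under eq_Rintegral do rewrite mul0r; rewrite Rintegral_cst// mul0r.
Qed.

Lemma L2dot_suml (I : finType) (c : I -> R) (e : I -> T -> R) h :
  (forall i, e i \in L2) -> h \in L2 ->
  L2dot mu (fun x => \sum_i c i * e i x) h = \sum_i c i * L2dot mu (e i) h.
Proof.
move=> eL hL; suff : forall s : seq I, (fun x => \sum_(i <- s) c i * e i x) \in L2 /\
    L2dot mu (fun x => \sum_(i <- s) c i * e i x) h =
    \sum_(i <- s) c i * L2dot mu (e i) h by move=> /(_ (index_enum I))[].
elim=> [|i s [IH1 IH2]].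
  by under eq_fun do rewrite big_nil; rewrite big_nil L2dot0l; split => //; exact: Lfun2_cst0.
under eq_fun do rewrite big_cons; rewrite big_cons -IH2 -L2dot_lin//; split => //.
exact: Lfun2_lin.
Qed.

Lemma L2dot_ge0 f : 0 <= L2dot mu f f.
Proof. by apply: Rintegral_ge0 => x _; rewrite -expr2 sqr_ge0. Qed.

Lemma L2dotE f : f \in L2 -> (\int[mu]_x (f x ^+ 2)%:E = (L2dot mu f f)%:E)%E.
Proof.
move=> fL; rewrite /L2dot /Rintegral fineK.
  by apply: eq_integral => x _; rewrite expr2.
by apply: integrable_fin_num => //; exact: Lfun2_mul_integrable.
Qed.

Lemma L2dot_lin2 c f g : f \in L2 -> g \in L2 ->
  L2dot mu (fun x => c * f x + g x) (fun x => c * f x + g x) =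
  c ^+ 2 * L2dot mu f f + 2 * c * L2dot mu f g + L2dot mu g g.
Proof.
move=> fL gL; have hL := Lfun2_lin c fL gL.
rewrite L2dot_lin// (L2dotC f) (L2dotC g) !L2dot_lin// (L2dotC g f); ring.
Qed.

Lemma L2dot_CauchySchwarz f g : f \in L2 -> g \in L2 ->
  L2dot mu f g ^+ 2 <= L2dot mu f f * L2dot mu g g.
Proof.
move=> fL gL; apply: discriminant_le => t.
have := L2dot_ge0 (fun x => t * g x + f x); rewrite L2dot_lin2// (L2dotC g f).
by congr (0 <= _); ring.
Qed.

Lemma L2dot_ae_eq f f' g g' : f \in L2 -> f' \in L2 -> g \in L2 -> g' \in L2 ->
  f = f' %[ae mu] -> g = g' %[ae mu] -> L2dot mu f g = L2dot mu f' g'.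
Proof.
move=> fL fL' gL gL' ff' gg'; congr fine; apply: ae_eq_integral => //.
- by apply/measurable_EFinP/measurable_funM; 
    [exact: Lfun_measurable fL|exact: Lfun_measurable gL].
- by apply/measurable_EFinP/measurable_funM; 
    [exact: Lfun_measurable fL'|exact: Lfun_measurable gL'].
by apply: filterS2 ff' gg' => x fx gx _; rewrite fx// gx.
Qed.

Lemma L2dot_ae_eql f f' g : f \in L2 -> f' \in L2 -> g \in L2 ->
  f = f' %[ae mu] -> L2dot mu f g = L2dot mu f' g.
Proof. by move=> fL fL' gL ff'; apply: L2dot_ae_eq => //; exact: nearW. Qed.

Lemma L2dot_eq0 f : f \in L2 -> L2dot mu f f = 0 -> f = cst 0 %[ae mu].
Proof.
move=> fL f0; have mf := Lfun_measurable fL.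
have : (\int[mu]_x `|(f x ^+ 2)%:E| = 0)%E.
  under eq_integral do rewrite gee0_abs ?lee_fin ?sqr_ge0//.
  by rewrite L2dotE// f0.
move/(ae_eq_integral_abs mu measurableT) => H.
have mf2 : measurable_fun setT (fun x => (f x ^+ 2)%:E).
  exact/measurable_EFinP/measurable_funX.
apply: filterS (H mf2) => x /= /[apply] /eqP.
by rewrite eqe sqrf_eq0 => /eqP.
Qed.

Lemma Lnorm2E f : f \in L2 ->
  ('N[mu]_2%:E[EFin \o f] = (Num.sqrt (L2dot mu f f))%:E)%E.
Proof.
move=> fL; rewrite unlock /Lnorm/=.
under eq_integral do rewrite /= powR_mulrn// real_normK ?num_real//.
by rewrite L2dotE// poweR_EFin powR12_sqrt// L2dot_ge0.
Qed.

End L2_inner_product.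

(** * Weak sequential compactness *)

(** By Tychonoff's theorem the sequence of rows has a cluster point [p] in the
    product of the segments [[- B j, B j]]. The [k]-th index is then chosen so
    that the first [k] coordinates are within [1 / (k + 1)] of those of [p]. *)
Lemma diagonal_extraction (R : realType) (x : nat -> nat -> R) (B : nat -> R) :
  (forall i j, `|x i j| <= B j) ->
  exists2 phi : nat -> nat, {homo phi : i j / (i < j)%N} &
    forall j, cvgn (fun i => x (phi i) j).
Proof.
move=> xB.
pose K := [set f : nat -> R | forall j, f j \in `[- B j, B j]].
have cK : compact (K : set (prod_topology (fun=> R : topologicalType))).
  exact: (tychonoff (fun j => @segment_compact R (- B j) (B j))).
pose X : nat -> prod_topology (fun=> R : topologicalType) := x.
have XK : (X @ \oo) K.
  by exists 0%N => // i _ j /=; rewrite in_itv/= -ler_norml.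
have [p [Kp pX]] := cK _ _ XK.
have near_p k N : exists i, (N <= i)%N /\
    forall j, (j <= k)%N -> `|p j - x i j| < k.+1%:R^-1.
  have nU : nbhs p [set f : prod_topology (fun=> R : topologicalType) |
      forall j, (j < k.+1)%N -> `|p j - f j| < k.+1%:R^-1].
    elim: {-2}k.+1 => [|m IH]; first exact: filterE.
    have pm : nbhs p [set f : prod_topology (fun=> R : topologicalType) |
        `|p m - f m| < k.+1%:R^-1].
      have pc : (f m : R) @[f --> p] --> (p m : R).
        exact: (@proj_continuous nat (fun=> R : topologicalType) m p).
      have k0 : 0 < k.+1%:R^-1 :> R by rewrite invr_gt0.
      exact: (cvgrPdist_lt _ _).1 pc _ k0.
    apply: filterS2 IH pm => f fl fm j; rewrite ltnS leq_eqVlt => /predU1P[->//|].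
    exact: fl.
  have FN : (X @ \oo) [set f | exists2 i, (N <= i)%N & f = X i].
    by exists N => // i /= Ni; exists i.
  have [f [[i Ni ->] fU]] := pX _ _ FN nU.
  by exists i; split => // j jk; exact: fU.
pose next k N := sval (cid (near_p k N)).
pose phi := fix phi k := if k is k'.+1 then next k (phi k').+1 else next 0%N 0%N.
have phiS k : (phi k < phi k.+1)%N.
  by rewrite /= /next; case: cid => i []/=.
have phiP k j : (j <= k)%N -> `|p j - x (phi k) j| < k.+1%:R^-1.
  by case: k => [|k] /=; rewrite /next; case: cid => i [_ +] /=; apply.
exists phi; first exact: homo_ltn ltn_trans phiS.
move=> j; apply/cvg_ex; exists (p j); apply/cvgrPdist_lt => e e0.
near=> k; have jk : (j <= k)%N by near: k; exact: nbhs_infty_ge.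
apply: lt_trans (phiP k j jk) _; near: k.
exact: near_infty_natSinv_lt (PosNum e0).
Unshelve. all: by end_near. Qed.

Section weak_compactness.
Context d (T : measurableType d) (R : realType).
Variable mu : {measure set T -> \bar R}.
Local Notation L2 := (Lfun mu 2%:E).
Implicit Types (f g h v : T -> R) (c : R) (u : nat -> T -> R).

(** The [v] for which [<u i, v>] converges form a subspace [S] containing every
    [u j]. If [v] in [S] almost minimizes the distance from [g] to [S], then
    [g - v] is almost orthogonal to all the [u i], since otherwise a step along
    [u i] would bring [v] closer to [g]. Hence [<u i, g>] is a uniform limit of
    convergent sequences. *)
Lemma weak_cvg_of_gram u (M : R) : (forall i, u i \in L2) ->
  (forall i, L2dot mu (u i) (u i) <= M) ->
  (forall j, cvgn (fun i => L2dot mu (u i) (u j))) ->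
  forall g, g \in L2 -> cvgn (fun i => L2dot mu (u i) g).
Proof.
move=> uL uM gram g gL.
pose S : set (T -> R) := [set v | v \in L2 /\ cvgn (fun i => L2dot mu (u i) v)].
have S0 : S (fun=> 0).
  split; first exact: Lfun2_cst0.
  by under eq_fun do rewrite L2dotC L2dot0l; exact: is_cvg_cst.
have SD t i v : S v -> S (fun x => t * u i x + v x).
  move=> [vL cv]; split; first exact: Lfun2_lin.
  under eq_fun do rewrite L2dotC L2dot_lin// L2dotC (L2dotC _ v).
  by apply: is_cvgD => //; apply: is_cvgM; [exact: is_cvg_cst|exact: gram].
have gvL v : v \in L2 -> (fun x => -1 * v x + g x) \in L2.
  by move=> vL; exact: Lfun2_lin.
pose dist v := L2dot mu (fun x => -1 * v x + g x) (fun x => -1 * v x + g x).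
have hinf : has_inf (dist @` S).
  split; first by exists (dist (fun=> 0)); exists (fun=> 0).
  by exists 0 => _ [v _ <-]; exact: L2dot_ge0.
have near_g (e : R) : 0 < e -> exists2 v, S v &
    forall i, (L2dot mu (u i) g - L2dot mu (u i) v) ^+ 2 <= e * M.
  move=> e0; have [_ [v Sv <-] vd] := inf_adherent e0 hinf.
  have [vL _] := Sv; exists v => // i.
  apply: le_trans (_ : e * L2dot mu (u i) (u i) <= _); last first.
    by rewrite ler_pM2l.
  apply: discriminant_le => t.
  have : inf (dist @` S) <= dist (fun x => - t * u i x + v x).
    by apply: ge_inf; [exact: hinf.2|exact/imageP/SD].
  have -> : dist (fun x => - t * u i x + v x) =
      L2dot mu (fun x => t * u i x + (-1 * v x + g x))
               (fun x => t * u i x + (-1 * v x + g x)).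
    by apply: eq_Rintegral => x _; ring.
  rewrite L2dot_lin2 ?gvL// (L2dotC _ (u i)) L2dot_lin// -/(dist v).
  by rewrite (L2dotC _ v) (L2dotC _ g); lra.
have M0 : 0 <= M := le_trans (L2dot_ge0 mu (u 0%N)) (uM 0%N).
suff : cauchy_ex ((fun i => L2dot mu (u i) g) @ \oo).
  by move=> /cauchy_exP; exact: cauchy_cvg.
move=> e e0.
have e'0 : 0 < (e / 2) ^+ 2 / (M + 1).
  by rewrite divr_gt0 ?exprn_gt0 ?divr_gt0// ltr_wpDl.
have [v [vL cv] vg] := near_g _ e'0.
exists (limn (fun i => L2dot mu (u i) v)).
have e20 : 0 < e / 2 by rewrite divr_gt0.
have [N _ vN] := (cvgrPdist_lt (fun i => L2dot mu (u i) v) _).1 cv _ e20.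
exists N => // i /vN /= vl; rewrite -ball_normE /=.
rewrite [ltRHS]splitr (le_lt_trans (ler_distD (L2dot mu (u i) v) _ _))//.
rewrite ltr_leD// distrC -(@ler_pXn2r _ 2) ?nnegrE ?(ltW e20)//.
rewrite real_normK ?num_real// (le_trans (vg i))//.
by rewrite mulrAC ler_pdivrMr ?ler_pM2l ?exprn_gt0 ?lerDl// ltr_wpDl.
Qed.

Theorem weak_compactness u (M : R) : (forall i, u i \in L2) ->
  (forall i, L2dot mu (u i) (u i) <= M) ->
  exists2 phi : nat -> nat, {homo phi : i j / (i < j)%N} &
    forall g, g \in L2 -> cvgn (fun i => L2dot mu (u (phi i)) g).
Proof.
move=> uL uM.
have M0 : 0 <= M := le_trans (L2dot_ge0 mu (u 0%N)) (uM 0%N).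
have [|phi phi_incr gram] :=
    @diagonal_extraction R (fun i j => L2dot mu (u i) (u j)) (fun=> M).
  move=> i j; rewrite -(@ler_pXn2r _ 2) ?nnegrE// real_normK ?num_real//.
  apply: le_trans (L2dot_CauchySchwarz (uL i) (uL j)) _.
  by rewrite expr2 ler_pM ?L2dot_ge0.
exists phi => // g gL.
apply: (@weak_cvg_of_gram (u \o phi) M) gL => [i|i|j].
- exact: uL.
- exact: uM.
- exact: gram.
Qed.

End weak_compactness.

(** * Orthonormal families *)

Section orthonormal.
Context d (T : measurableType d) (R : realType).
Variable mu : {measure set T -> \bar R}.
Local Notation L2 := (Lfun mu 2%:E).

Definition L2_orthonormal (I : finType) (e : I -> T -> R) :=
  (forall i, e i \in L2) /\ forall i j, L2dot mu (e i) (e j) = (i == j)%:R.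

Lemma orthonormal_dot_sum (I : finType) (e : I -> T -> R) (c : I -> R) j :
  L2_orthonormal e -> L2dot mu (fun x => \sum_i c i * e i x) (e j) = c j.
Proof.
move=> [eL eo]; rewrite L2dot_suml// (bigD1 j)//= eo eqxx mulr1 big1 ?addr0//.
by move=> i /negbTE ij; rewrite eo ij mulr0.
Qed.

Lemma bessel (I : finType) (e : I -> T -> R) g : L2_orthonormal e -> g \in L2 ->
  \sum_i L2dot mu g (e i) ^+ 2 <= L2dot mu g g.
Proof.
move=> eo gL; have [eL _] := eo.
pose c i := L2dot mu g (e i); pose s x := \sum_i c i * e i x.
have sL : s \in L2 by exact: Lfun2_sum.
have sg : L2dot mu s g = \sum_i c i ^+ 2.
  by rewrite L2dot_suml//; apply: eq_bigr => i _; rewrite L2dotC expr2.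
have ss : L2dot mu s s = \sum_i c i ^+ 2.
  rewrite {1}/s L2dot_suml//; apply: eq_bigr => i _.
  by rewrite L2dotC orthonormal_dot_sum.
have := L2dot_ge0 mu (fun x => -1 * s x + g x).
by rewrite L2dot_lin2// sg ss -/c => ?; lra.
Qed.

(** Orthonormal families of size [k < m] can be extended inside [W]: if every
    residual of [e] on such a family vanished, the [m] functions [e i] would be
    combinations of [k] functions, and a nonzero row of the kernel of the
    [m] by [k] matrix of coefficients would contradict the freeness of [e]. *)
Lemma gram_schmidt (W : set (T -> R)) m (e : 'I_m -> T -> R) :
  W `<=` [set f | f \in L2] -> W (fun=> 0) ->
  (forall (c : R) f g, W f -> W g -> W (fun x => c * f x + g x)) ->
  (forall i, W (e i)) -> L2_free mu e ->
  exists2 f : 'I_m -> T -> R, L2_orthonormal f & forall i, W (f i).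
Proof.
move=> WL W0 WD We efree.
have eL i : e i \in L2 by exact: WL.
have Wsum (I : finType) (c : I -> R) (f : I -> T -> R) : (forall i, W (f i)) ->
    W (fun x => \sum_i c i * f i x).
  move=> Wf; elim: (index_enum I) => [|i s IH].
    by under eq_fun do rewrite big_nil.
  by under eq_fun do rewrite big_cons; exact: WD.
suff H k : (k <= m)%N -> exists2 f : 'I_k -> T -> R, L2_orthonormal f &
    forall i, W (f i) by exact: H.
elim: k => [_|k IH km].
  by exists (fun i => e (widen_ord (leq0n m) i)) => [|[]//]; split => -[].
have [f fo Wf] := IH (ltnW km); have [fL fd] := fo.
pose A := \matrix_(i < m, j < k) L2dot mu (e i) (f j).
pose r i x := -1 * (\sum_j A i j * f j x) + e i x.
have Wr i : W (r i) by apply: WD => //; exact: Wsum.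
have rL i : r i \in L2 by exact: WL.
have r_orth i j : L2dot mu (r i) (f j) = 0.
  rewrite L2dot_lin//; last exact/WL/Wsum.
  by rewrite orthonormal_dot_sum// mxE; ring.
have [i ri0] : exists i, L2dot mu (r i) (r i) != 0.
  apply: contrapT => /forallNP r0.
  have : kermx A != 0.
    rewrite -mxrank_eq0 mxrank_ker subn_eq0 -ltnNge.
    exact: leq_ltn_trans (rank_leq_col A) km.
  move=> /matrix0Pn[i0 [i1]]; pose c := row i0 (kermx A).
  have cA : c *m A = 0 by rewrite /c -row_mul mulmx_ker row0.
  apply/negP; rewrite negbK; apply/eqP.
  have -> : kermx A i0 i1 = c ord0 i1 by rewrite [RHS]mxE.
  apply: (efree (c ord0)).
  have r0' i : r i = cst 0 %[ae mu].
    by apply: L2dot_eq0 => //; apply/eqP/negPn/negP/r0.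
  have r0a : \forall x \ae mu, forall i, r i x = 0.
    by apply: filter_forall => i; apply: filterS (r0' i) => x; apply.
  apply: filterS r0a => x r0x _.
  have ex i : e i x = \sum_j A i j * f j x.
    by have := r0x i; rewrite /r; lra.
  under eq_bigr do rewrite ex mulr_sumr.
  rewrite exchange_big/= big1// => j _.
  under eq_bigr do rewrite mulrA; rewrite -mulr_suml.
  have /matrixP/(_ ord0 j) := cA; rewrite !mxE => ->; exact: mul0r.
have r_gt0 : 0 < L2dot mu (r i) (r i) by rewrite lt0r ri0 L2dot_ge0.
pose s := (Num.sqrt (L2dot mu (r i) (r i)))^-1.
pose q x := s * r i x + 0.
have Wq : W q by exact: WD.
have qL : q \in L2 by exact: WL.
have qf j : L2dot mu q (f j) = 0.
  rewrite L2dot_lin//; last exact: Lfun2_cst0.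
  by rewrite L2dot0l r_orth mulr0 addr0.
have qq : L2dot mu q q = 1.
  rewrite L2dot_lin2//; last exact: Lfun2_cst0.
  rewrite L2dot0l L2dotC L2dot0l mulr0 !addr0 exprVn sqr_sqrtr ?mulVf//.
  exact: L2dot_ge0.
exists (fun j : 'I_k.+1 => if unlift ord_max j is Some l then f l else q).
  split=> [j|j l]; first by case: unliftP => [a|] _.
  case: unliftP => [a|] ->; case: unliftP => [b|] ->.
  - by rewrite fd (inj_eq (@lift_inj _ _)).
  - by rewrite L2dotC qf eq_sym (negbTE (neq_lift _ _)).
  - by rewrite qf (negbTE (neq_lift _ _)).
  - by rewrite qq eqxx.
by move=> j; case: unliftP => [a|] _.
Qed.

End orthonormal.

(** * Hilbert-Schmidt operators *)

Section parametric_integral.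
Local Open Scope ereal_scope.
Context d1 d2 (T1 : measurableType d1) (T2 : measurableType d2) (R : realType).
Variable m1 : {sigma_finite_measure set T1 -> \bar R}.

Lemma measurable_parametric_integral (g : T1 * T2 -> \bar R) :
  measurable_fun setT g -> measurable_fun setT (fun y => \int[m1]_x g (x, y)).
Proof.
move=> mg.
have -> : (fun y => \int[m1]_x g (x, y)) =
    (fun y => \int[m1]_x g^\+ (x, y) - \int[m1]_x g^\- (x, y)).
  apply/funext => y; rewrite integralE.
  by congr (_ - _); apply: eq_integral => x _; rewrite ?funeposE ?funenegE.
apply: emeasurable_funB.
- by apply: (measurable_fun_fubini_tonelli_G g^\+) => //; exact: measurable_funepos.
- by apply: (measurable_fun_fubini_tonelli_G g^\-) => //; exact: measurable_funeneg.
Qed.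

End parametric_integral.

Section hilbert_schmidt_kernel.
Context d1 d2 (T : measurableType d1) (Z : measurableType d2) (R : realType).
Variables (mu : {sigma_finite_measure set T -> \bar R})
  (nu : {sigma_finite_measure set Z -> \bar R}).

Definition HS_kernel (phi : T -> Z -> R) :=
  measurable_fun setT (fun p => phi p.1 p.2) /\
  (\int[mu]_x \int[nu]_z (phi x z ^+ 2)%:E < +oo)%E.

Definition HS_operator (phi : T -> Z -> R) (f : T -> R) (z : Z) : R :=
  L2dot mu (phi^~ z) f.

End hilbert_schmidt_kernel.

Lemma HS_kernel_swap d1 d2 (T : measurableType d1) (Z : measurableType d2)
    (R : realType) (mu : {sigma_finite_measure set T -> \bar R})
    (nu : {sigma_finite_measure set Z -> \bar R}) (phi : T -> Z -> R) :
  HS_kernel mu nu phi -> HS_kernel nu mu (fun z x => phi x z).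
Proof.
move=> [mphi phi_fin]; split.
  exact: (measurableT_comp mphi (@measurable_swap _ _ Z T)).
have mphi2 : measurable_fun setT (fun p => (phi p.1 p.2 ^+ 2)%:E).
  exact/measurable_EFinP/measurable_funX.
have phi2_ge0 (p : T * Z) : (0 <= (phi p.1 p.2 ^+ 2)%:E)%E by rewrite lee_fin sqr_ge0.
by rewrite -(fubini_tonelli _ mphi2 phi2_ge0).
Qed.

Section hilbert_schmidt.
Context d1 d2 (T : measurableType d1) (Z : measurableType d2) (R : realType).
Variables (mu : {sigma_finite_measure set T -> \bar R})
  (nu : {sigma_finite_measure set Z -> \bar R}) (phi : T -> Z -> R).
Hypothesis HS : HS_kernel mu nu phi.
Local Notation P := (HS_operator mu phi).
Local Notation Pt := (HS_operator nu (fun z x => phi x z)).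

Let mphi : measurable_fun setT (fun p => phi p.1 p.2) := HS.1.

Let mphi2 : measurable_fun setT (fun p => (phi p.1 p.2 ^+ 2)%:E).
Proof. exact/measurable_EFinP/measurable_funX. Qed.

Let phi2_ge0 (p : T * Z) : (0 <= (phi p.1 p.2 ^+ 2)%:E)%E.
Proof. by rewrite lee_fin sqr_ge0. Qed.

Let mphil z : measurable_fun setT (phi^~ z).
Proof. exact: (measurableT_comp mphi (@pair2_measurable _ _ T Z z)). Qed.

Definition HS_section_norm2 z : \bar R := (\int[mu]_x (phi x z ^+ 2)%:E)%E.

Definition HS_norm2 : R := fine (\int[nu]_z HS_section_norm2 z)%E.

Lemma HS_section_norm2_ge0 z : (0 <= HS_section_norm2 z)%E.
Proof. by apply: integral_ge0 => x _; rewrite lee_fin sqr_ge0. Qed.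

Lemma integrable_HS_section_norm2 : nu.-integrable setT HS_section_norm2.
Proof.
apply/integrableP; split.
  exact: (measurable_fun_fubini_tonelli_G _ mphi2 phi2_ge0).
under eq_integral do rewrite gee0_abs ?HS_section_norm2_ge0//.
exact: (HS_kernel_swap HS).2.
Qed.

Lemma HS_norm2E : (\int[nu]_z HS_section_norm2 z = HS_norm2%:E)%E.
Proof. by rewrite fineK//; exact: integrable_fin_num integrable_HS_section_norm2. Qed.

Lemma HS_section_Lfun2 : {ae nu, forall z, phi^~ z \in Lfun mu 2%:E}.
Proof.
have := integrable_ae measurableT integrable_HS_section_norm2.
apply: filterS => z /= /(_ I) zfin; apply/Lfun2P; split => //.
apply/integrableP; split; first exact/measurable_EFinP/measurable_funX.
under eq_integral do rewrite gee0_abs ?lee_fin ?sqr_ge0//.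
by rewrite -ge0_fin_numE// HS_section_norm2_ge0.
Qed.

Lemma measurable_HS_operator f : measurable_fun setT f -> measurable_fun setT (P f).
Proof.
move=> mf; apply: measurableT_comp => //.
apply: (@measurable_parametric_integral _ _ _ _ _ mu
  (fun p => (phi p.1 p.2 * f p.1)%:E)).
apply/measurable_EFinP/measurable_funM => //.
exact: measurableT_comp mf measurable_fst.
Qed.

Lemma HS_operator_section f : f \in Lfun mu 2%:E ->
  {ae nu, forall z, ((P f z ^+ 2)%:E <= (L2dot mu f f)%:E * HS_section_norm2 z)%E}.
Proof.
move=> fL; apply: filterS HS_section_Lfun2 => z zL.
rewrite /HS_section_norm2 L2dotE// -EFinM lee_fin mulrC.
exact: L2dot_CauchySchwarz.
Qed.

Lemma HS_operator_Lfun2 f : f \in Lfun mu 2%:E -> P f \in Lfun nu 2%:E.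
Proof.
move=> fL; have mPf := measurable_HS_operator (Lfun_measurable fL).
apply/Lfun2P; split => //; apply/integrableP; split.
  exact/measurable_EFinP/measurable_funX.
have iS := integrable_HS_section_norm2.
have /integrableP[_] := integrableZl measurableT (L2dot mu f f) iS.
apply: le_lt_trans; apply: ae_ge0_le_integral => //.
- by apply: measurableT_comp => //; exact/measurable_EFinP/measurable_funX.
- apply: measurableT_comp => //; apply: measurable_funeM.
  exact: measurable_int iS.
apply: filterS (HS_operator_section fL) => z zf _ /=.
rewrite ger0_norm ?sqr_ge0// gee0_abs//.
by rewrite mule_ge0 ?HS_section_norm2_ge0// lee_fin L2dot_ge0.
Qed.

Lemma HS_operator_bounded f : f \in Lfun mu 2%:E ->
  L2dot nu (P f) (P f) <= HS_norm2 * L2dot mu f f.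
Proof.
move=> fL; rewrite -lee_fin -L2dotE ?HS_operator_Lfun2// mulrC EFinM -HS_norm2E.
have iS := integrable_HS_section_norm2.
rewrite -integralZl//; apply: ae_ge0_le_integral => //.
- by move=> z _; rewrite lee_fin sqr_ge0.
- by apply/measurable_EFinP/measurable_funX/measurable_HS_operator/(Lfun_measurable fL).
- by move=> z _; rewrite mule_ge0 ?HS_section_norm2_ge0// lee_fin L2dot_ge0.
- by apply: measurable_funeM; exact: measurable_int iS.
by apply: filterS (HS_operator_section fL).
Qed.

Lemma HS_operator_lin c f g z : phi^~ z \in Lfun mu 2%:E ->
  f \in Lfun mu 2%:E -> g \in Lfun mu 2%:E ->
  P (fun x => c * f x + g x) z = c * P f z + P g z.
Proof.
by move=> zL fL gL; rewrite /HS_operator L2dotC L2dot_lin// !(L2dotC _ (phi^~ z)).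
Qed.

Lemma HS_operator_ae_eq f g : f \in Lfun mu 2%:E -> g \in Lfun mu 2%:E ->
  f = g %[ae mu] -> P f = P g.
Proof.
move=> fL gL fg; apply/funext => z; congr fine; apply: ae_eq_integral => //.
- by apply/measurable_EFinP/measurable_funM; [exact: mphil|exact: Lfun_measurable fL].
- by apply/measurable_EFinP/measurable_funM; [exact: mphil|exact: Lfun_measurable gL].
by apply: filterS fg => x /= fgx _; rewrite fgx.
Qed.

(** Because [2 * |phi * (f * u)| <= phi ^+ 2 + (f * u) ^+ 2]. *)
Lemma HS_pairing_integrable f u : f \in Lfun mu 2%:E -> u \in Lfun nu 2%:E ->
  (mu \x nu)%E.-integrable setT (fun p => (phi p.1 p.2 * f p.1 * u p.2)%:E).
Proof.
move=> fL uL; have [mf mu'] := (Lfun_measurable fL, Lfun_measurable uL).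
have mf1 : measurable_fun setT (fun p : T * Z => f p.1).
  exact: measurableT_comp mf measurable_fst.
have mu2 : measurable_fun setT (fun p : T * Z => u p.2).
  exact: measurableT_comp mu' measurable_snd.
have i1 : (mu \x nu)%E.-integrable setT (fun p => (phi p.1 p.2 ^+ 2)%:E).
  apply/integrable12ltyP => //.
  under eq_integral do under eq_integral do rewrite /= ger0_norm ?sqr_ge0//.
  exact: HS.2.
have i2 : (mu \x nu)%E.-integrable setT (fun p => ((f p.1 * u p.2) ^+ 2)%:E).
  apply/integrable12ltyP.
    by apply/measurable_EFinP/measurable_funX/measurable_funM.
  under eq_integral => x _.
    under eq_integral do rewrite /= ger0_norm ?sqr_ge0// exprMn EFinM.
    rewrite ge0_integralZl//; last 3 first.
    - exact/measurable_EFinP/measurable_funX.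
    - by move=> z _; rewrite lee_fin sqr_ge0.
    - by rewrite lee_fin sqr_ge0.
    rewrite L2dotE//; over.
  have := Lfun2_integrable_sqr fL.
  move=> /(integralZr measurableT) /= ->.
  by rewrite L2dotE// ltry.
apply: le_integrable (integrableD measurableT i1 i2) => //.
  by apply/measurable_EFinP/measurable_funM => //; exact: measurable_funM.
move=> p _ /=; rewrite lee_fin -mulrA normrM [leRHS]ger0_norm ?addr_ge0 ?sqr_ge0//.
rewrite -[X in X + _]real_normK ?num_real// -[X in _ + X]real_normK ?num_real//.
have := sqr_ge0 (`|phi p.1 p.2| - `|f p.1 * u p.2|).
have := sqr_ge0 (`|phi p.1 p.2| + `|f p.1 * u p.2|); nra.
Qed.

End hilbert_schmidt.

Lemma integral_L2dotZ d (T : measurableType d) (R : realType)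
    (mu : {measure set T -> \bar R}) (c : R) (f g : T -> R) :
  f \in Lfun mu 2%:E -> g \in Lfun mu 2%:E ->
  (\int[mu]_x (c * (f x * g x))%:E = (c * L2dot mu f g)%:E)%E.
Proof.
move=> fL gL; under eq_integral do rewrite EFinM.
rewrite integralZl//; last exact: Lfun2_mul_integrable.
rewrite EFinM /L2dot /Rintegral fineK//; apply: integrable_fin_num => //.
exact: Lfun2_mul_integrable.
Qed.

Section hilbert_schmidt_adjoint.
Context d1 d2 (T : measurableType d1) (Z : measurableType d2) (R : realType).
Variables (mu : {sigma_finite_measure set T -> \bar R})
  (nu : {sigma_finite_measure set Z -> \bar R}) (phi : T -> Z -> R).
Hypothesis HS : HS_kernel mu nu phi.
Local Notation P := (HS_operator mu phi).
Local Notation Pt := (HS_operator nu (fun z x => phi x z)).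

(** Both sides are iterated integrals of [phi x z * f x * u z]. *)
Theorem HS_adjoint f u : f \in Lfun mu 2%:E -> u \in Lfun nu 2%:E ->
  L2dot nu (P f) u = L2dot mu f (Pt u).
Proof.
move=> fL uL; have iF := HS_pairing_integrable HS fL uL.
have mPf := measurable_HS_operator HS (Lfun_measurable fL).
have mPtu := measurable_HS_operator (HS_kernel_swap HS) (Lfun_measurable uL).
congr fine; symmetry.
transitivity (\int[mu]_x \int[nu]_z (phi x z * f x * u z)%:E)%E.
  apply: ae_eq_integral => //.
  - by apply/measurable_EFinP/measurable_funM => //; exact: Lfun_measurable fL.
  - exact: measurable_fubini_F iF.
  apply: filterS (HS_section_Lfun2 (HS_kernel_swap HS)) => x xL _.
  rewrite /HS_operator -integral_L2dotZ//.
  by apply: eq_integral => z _; congr EFin; ring.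
rewrite (Fubini iF) /=; apply: ae_eq_integral => //.
- exact: measurable_fubini_G iF.
- by apply/measurable_EFinP/measurable_funM => //; exact: Lfun_measurable uL.
apply: filterS (HS_section_Lfun2 HS) => z zL _.
rewrite /HS_operator mulrC -integral_L2dotZ//.
by apply: eq_integral => x _; congr EFin; ring.
Qed.

(** The kernel of [Pt \o P], extended-real valued because its diagonal may be
    infinite on a null set. *)
Definition HS_square (x' x : T) : \bar R := (\int[nu]_z (phi x' z * phi x z)%:E)%E.

Hypothesis phi_ge0 : forall x z, 0 <= phi x z.

Lemma measurable_HS_square :
  measurable_fun setT (fun p : T * T => HS_square p.1 p.2).
Proof.
have mphi3 (i : T * T -> T) : measurable_fun setT i ->
    measurable_fun setT (fun p : (T * T) * Z => phi (i p.1) p.2).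
  move=> mi; apply: (measurableT_comp HS.1 (f := fun p => phi p.1 p.2)
    (g := fun p : (T * T) * Z => (i p.1, p.2))).
  by apply: measurable_fun_pair => //; exact: measurableT_comp.
apply: (measurable_fun_fubini_tonelli_F
  (fun p : (T * T) * Z => (phi p.1.1 p.2 * phi p.1.2 p.2)%:E)).
  by apply/measurable_EFinP/measurable_funM; exact: mphi3.
by move=> p; rewrite lee_fin mulr_ge0.
Qed.

Lemma HS_square_ae : {ae mu, forall x, (phi x) \in Lfun nu 2%:E /\
  {ae mu, forall x', HS_square x' x = (Pt (phi x) x')%:E}}.
Proof.
have sec := HS_section_Lfun2 (HS_kernel_swap HS).
apply: filterS (sec) => x xL; split => //; apply: filterS sec => x' xL'.
rewrite /HS_square /HS_operator -[L2dot _ _ _]mul1r -integral_L2dotZ//.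
by under [RHS]eq_integral do rewrite mul1r.
Qed.

Lemma measurable_HS_square_mul (f : T -> R) : measurable_fun setT f ->
  measurable_fun setT (fun p : T * T => (f p.1)%:E * HS_square p.1 p.2)%E.
Proof.
move=> mf; apply: emeasurable_funM; last exact: measurable_HS_square.
by apply/measurable_EFinP; exact: measurableT_comp mf measurable_fst.
Qed.

Lemma measurable_HS_square_section (f : T -> R) x : measurable_fun setT f ->
  measurable_fun setT (fun x' => (f x')%:E * HS_square x' x)%E.
Proof.
move=> mf.
exact: (measurableT_comp (measurable_HS_square_mul mf) (@pair2_measurable _ _ T T x)).
Qed.

Lemma HS_square_defined : kernel_operator_defined mu HS_square mu.
Proof.
move=> f fL; apply: filterS HS_square_ae => x [xL sq].
have mf := Lfun_measurable fL.
have PtL := HS_operator_Lfun2 (HS_kernel_swap HS) xL.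
have /integrableP[mfPt fin] := Lfun2_mul_integrable fL PtL.
apply/integrableP; split; first exact: measurable_HS_square_section.
rewrite (_ : integral _ _ _ = (\int[mu]_x' `|(f x' * Pt (phi x) x')%:E|)%E)//.
apply: ae_eq_integral => //.
- by apply: measurableT_comp => //; exact: measurable_HS_square_section.
- exact: measurableT_comp.
by apply: filterS sq => x' /= -> _.
Qed.

(** At a point [x] whose section is square-integrable, this is [HS_adjoint] for
    [u := phi x]. *)
Lemma kernel_operator_HS_square f : f \in Lfun mu 2%:E ->
  kernel_operator mu HS_square f = Pt (P f) %[ae mu].
Proof.
move=> fL; apply: filterS HS_square_ae => x [xL sq] _.
have mf := Lfun_measurable fL.
have PtL := HS_operator_Lfun2 (HS_kernel_swap HS) xL.
rewrite /HS_operator L2dotC HS_adjoint//; congr fine; apply: ae_eq_integral => //.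
- exact: measurable_HS_square_section.
- exact: measurable_int (Lfun2_mul_integrable fL PtL).
by apply: filterS sq => x' /= -> _.
Qed.

Lemma kernel_operator_HS_square_Lfun2 f : f \in Lfun mu 2%:E ->
  kernel_operator mu HS_square f \in Lfun mu 2%:E.
Proof.
move=> fL; apply: (@Lfun2_ae_eq _ _ _ _ (Pt (P f))).
- exact/(HS_operator_Lfun2 (HS_kernel_swap HS))/HS_operator_Lfun2.
- apply: measurableT_comp => //.
  apply: (@measurable_parametric_integral _ _ _ _ _ mu
    (fun p => (f p.1)%:E * HS_square p.1 p.2)%E).
  exact: (measurable_HS_square_mul (Lfun_measurable fL)).
by apply: filterS (kernel_operator_HS_square fL) => x + xT => ->.
Qed.

End hilbert_schmidt_adjoint.

(** * The square of a Hilbert-Schmidt operator is trace-class *)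

Lemma cvg_sqr (R : realType) (a : nat -> R) (l : R) :
  a i @[i --> \oo] --> l -> a i ^+ 2 @[i --> \oo] --> l ^+ 2.
Proof. by move=> al; under eq_fun do rewrite expr2; rewrite expr2; exact: cvgM. Qed.

Section hilbert_schmidt_compact.
Context d1 d2 (T : measurableType d1) (Z : measurableType d2) (R : realType).
Variables (mu : {sigma_finite_measure set T -> \bar R})
  (nu : {sigma_finite_measure set Z -> \bar R}) (phi : T -> Z -> R).
Hypothesis HS : HS_kernel mu nu phi.
Local Notation P := (HS_operator mu phi).

(** Along a weakly convergent subsequence, [P (u i) z] is the inner product of
    [u i] with the section of [phi] at [z], so it converges for almost every
    [z]. The sections also dominate it, and dominated convergence turns
    pointwise convergence into convergence in L^2. *)
Theorem HS_operator_compact (u : nat -> T -> R) (M : R) :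
  (forall i, u i \in Lfun mu 2%:E) -> (forall i, L2dot mu (u i) (u i) <= M) ->
  exists2 s : nat -> nat, {homo s : i j / (i < j)%N} &
  exists2 v : Z -> R, v \in Lfun nu 2%:E &
    L2dot nu (fun z => -1 * v z + P (u (s i)) z)
             (fun z => -1 * v z + P (u (s i)) z) @[i --> \oo] --> (0 : R).
Proof.
move=> uL uM.
have M0 : 0 <= M := le_trans (L2dot_ge0 mu (u 0%N)) (uM 0%N).
have [s s_incr s_cvg] := weak_compactness uL uM; exists s => //.
pose v z := fine (limn_esup (fun i => (P (u (s i)) z)%:E)).
have mP i : measurable_fun setT (P (u (s i))).
  exact: (measurable_HS_operator HS (Lfun_measurable (uL (s i)))).
have mv : measurable_fun setT v.
  apply: measurableT_comp => //; apply: measurable_fun_limn_esup => i.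
  exact/measurable_EFinP.
(* Where the section of [phi] is square-integrable the limit superior defining
   [v] is a limit. *)
have v_cvg : {ae nu, forall z, P (u (s i)) z @[i --> \oo] --> v z}.
  apply: filterS (HS_section_Lfun2 HS) => z zL.
  have c : cvgn (fun i => P (u (s i)) z).
    by under eq_fun do rewrite /HS_operator L2dotC; exact: s_cvg.
  have cE : (P (u (s i)) z)%:E @[i --> \oo] --> (limn (fun i => P (u (s i)) z))%:E.
    by apply: cvg_EFin => //; exact: nearW.
  rewrite /v is_cvg_limn_esupE; last by apply/cvg_ex; eexists; exact: cE.
  by rewrite (cvg_lim _ cE).
pose S := HS_section_norm2 mu phi.
have S0 z : (0 <= S z)%E by exact: HS_section_norm2_ge0.
have iS : nu.-integrable setT S by exact: integrable_HS_section_norm2.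
have P_le : {ae nu, forall z, forall i, ((P (u (s i)) z ^+ 2)%:E <= M%:E * S z)%E}.
  apply: filterS (HS_section_Lfun2 HS) => z zL i.
  rewrite /S /HS_section_norm2 L2dotE// -EFinM lee_fin.
  apply: le_trans (L2dot_CauchySchwarz zL (uL (s i))) _.
  by rewrite mulrC ler_wpM2r// L2dot_ge0.
have v_le : {ae nu, forall z, ((v z ^+ 2)%:E <= M%:E * S z)%E}.
  apply: filterS3 (HS_section_Lfun2 HS) v_cvg P_le => z zL c le_i.
  rewrite /S /HS_section_norm2 L2dotE// -EFinM lee_fin.
  have c2 : P (u (s i)) z ^+ 2 @[i --> \oo] --> v z ^+ 2 by exact: cvg_sqr.
  rewrite -(cvg_lim _ c2)//; apply: limr_le; first by apply/cvg_ex; eexists; exact: c2.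
  apply: nearW => i; have := le_i i.
  by rewrite /S /HS_section_norm2 L2dotE// -EFinM lee_fin.
have vL : v \in Lfun nu 2%:E.
  apply/Lfun2P; split => //; apply/integrableP; split.
    exact/measurable_EFinP/measurable_funX.
  have /integrableP[mMS] := integrableZl measurableT M iS.
  apply: le_lt_trans; apply: ae_ge0_le_integral => //.
  - by apply: measurableT_comp => //; exact/measurable_EFinP/measurable_funX.
  - exact: measurableT_comp.
  apply: filterS v_le => z zf _ /=.
  by rewrite ger0_norm ?sqr_ge0// gee0_abs// mule_ge0 ?lee_fin.
exists v => //.
have PL i : P (u (s i)) \in Lfun nu 2%:E by exact: HS_operator_Lfun2.
pose W i z := -1 * v z + P (u (s i)) z.
have WL i : W i \in Lfun nu 2%:E by exact: Lfun2_lin.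
have mW i : measurable_fun setT (fun z => (W i z ^+ 2)%:E).
  exact/measurable_EFinP/measurable_funX/(Lfun_measurable (WL i)).
suff H : (\int[nu]_z (W i z ^+ 2)%:E)%E @[i --> \oo] --> 0%E.
  have [_] := (fine_cvgP _ _).1 H.
  by apply: cvg_trans; apply: near_eq_cvg; near=> i; rewrite /= L2dotE.
rewrite -(integral0 nu setT).
(* [(P (u i) z - v z) ^+ 2] is at most [2 * P (u i) z ^+ 2 + 2 * v z ^+ 2]. *)
have [] // := @dominated_convergence _ _ _ nu setT measurableT
  (fun i z => (W i z ^+ 2)%:E) (cst 0%E) (fun z => (4 * M)%:E * S z)%E.
- apply: filterS v_cvg => z c _.
  have -> : cst 0%E z = (0 ^+ 2)%:E :> \bar R by rewrite expr0n.
  apply: cvg_EFin; first exact: nearW.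
  apply: cvg_sqr; have -> : 0 = -1 * v z + v z :> R by ring.
  by apply: cvgD => //; exact: cvg_cst.
- exact: integrableZl.
- apply: filterS3 (HS_section_Lfun2 HS) v_le P_le => z zL + le_i i _.
  have := le_i i; rewrite /S /HS_section_norm2 L2dotE// -!EFinM !lee_fin.
  rewrite ger0_norm ?sqr_ge0// /W => h1 h2.
  have := sqr_ge0 (v z + P (u (s i)) z); nra.
Unshelve. all: by end_near. Qed.

End hilbert_schmidt_compact.

Section hilbert_schmidt_trace_class.
Context d1 d2 (T : measurableType d1) (Z : measurableType d2) (R : realType).
Variables (mu : {sigma_finite_measure set T -> \bar R})
  (nu : {sigma_finite_measure set Z -> \bar R}) (phi : T -> Z -> R).
Hypothesis HS : HS_kernel mu nu phi.
Hypothesis phi_ge0 : forall x z, 0 <= phi x z.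
Local Notation P := (HS_operator mu phi).
Local Notation Pt := (HS_operator nu (fun z x => phi x z)).
Local Notation L2 := (Lfun mu 2%:E).
Local Notation tr := (HS_norm2 mu nu phi).

Variable K : (T -> R) -> T -> R.
Hypothesis KE : forall f, f \in L2 ->
  K f = kernel_operator mu (HS_square nu phi) f.

Let HSt := HS_kernel_swap HS.

Let KP f : f \in L2 -> K f = Pt (P f) %[ae mu].
Proof. by move=> fL; rewrite KE//; exact: kernel_operator_HS_square. Qed.

Let KL f : f \in L2 -> K f \in L2.
Proof. by move=> fL; rewrite KE//; exact: kernel_operator_HS_square_Lfun2. Qed.

Let PL f : f \in L2 -> P f \in Lfun nu 2%:E.
Proof. exact: HS_operator_Lfun2. Qed.

Let PtL f : f \in Lfun nu 2%:E -> Pt f \in L2.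
Proof. exact: HS_operator_Lfun2. Qed.

Let K_operator : L2_operator mu K.
Proof.
split=> // [f g fL gL fg|c f g fL gL].
  apply: filterS2 (KP fL) (KP gL) => x /(_ I) -> /(_ I) -> _.
  by rewrite (HS_operator_ae_eq HS fL gL fg).
have hL := Lfun2_lin c fL gL.
have Pl : P (fun x => c * f x + g x) = (fun z => c * P f z + P g z) %[ae nu].
  apply: filterS (HS_section_Lfun2 HS) => z zL _; exact: HS_operator_lin.
have PfgL := Lfun2_lin c (PL fL) (PL gL).
have PtE := HS_operator_ae_eq HSt (PL hL) PfgL Pl.
have lin : {ae mu, forall x, Pt (fun z => c * P f z + P g z) x =
    c * Pt (P f) x + Pt (P g) x}.
  by apply: filterS (HS_section_Lfun2 HSt) => x xL; apply: HS_operator_lin => //; exact: PL.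
have Kh : {ae mu, forall x, K (fun x => c * f x + g x) x =
    c * Pt (P f) x + Pt (P g) x}.
  by apply: filterS2 (KP hL) lin => x /(_ I) ->; rewrite PtE.
by apply: filterS3 Kh (KP fL) (KP gL) => x -> /(_ I) -> /(_ I) ->.
Qed.

(** Since [K] is [Pt \o P] almost everywhere; positivity and self-adjointness
    are read off this formula. *)
Let K_form f g : f \in L2 -> g \in L2 -> L2dot mu (K f) g = L2dot nu (P f) (P g).
Proof.
move=> fL gL; rewrite (L2dotC nu) HS_adjoint ?PL// [RHS]L2dotC.
by apply: L2dot_ae_eql => //; [exact: KL|exact/PtL/PL|exact: KP].
Qed.

Let K_self_adjoint : L2_self_adjoint mu K.
Proof. by move=> f g fL gL; rewrite K_form// L2dotC -K_form// L2dotC. Qed.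

Let K_compact : L2_compact mu K.
Proof.
move=> u uL [M uM].
have uM2 i : L2dot mu (u i) (u i) <= M ^+ 2.
  have := uM i; rewrite Lnorm2E// lee_fin => h.
  rewrite -[leLHS]sqr_sqrtr ?L2dot_ge0// ler_pXn2r// nnegrE ?sqrtr_ge0//.
  exact: le_trans h.
have [s s_incr [v vL sv]] := HS_operator_compact HS uL uM2.
exists s, (Pt v); split => //; first exact: PtL.
pose W i z := -1 * v z + P (u (s i)) z.
have WL i : W i \in Lfun nu 2%:E by apply: Lfun2_lin => //; exact: PL.
have DL i : (K (u (s i)) \- Pt v) \in L2.
  have -> : K (u (s i)) \- Pt v = (fun x => -1 * Pt v x + K (u (s i)) x).
    by apply/funext => x /=; ring.
  by apply: Lfun2_lin; [exact: PtL|exact: KL].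
have DW i : K (u (s i)) \- Pt v = Pt (W i) %[ae mu].
  apply: filterS2 (KP (uL (s i))) (HS_section_Lfun2 HSt) => x /(_ I) Kx xL _ /=.
  by rewrite Kx /W HS_operator_lin ?PL//; ring.
have D_le i : L2dot mu (K (u (s i)) \- Pt v) (K (u (s i)) \- Pt v) <=
    HS_norm2 nu mu (fun z x => phi x z) * L2dot nu (W i) (W i).
  have -> : L2dot mu (K (u (s i)) \- Pt v) (K (u (s i)) \- Pt v) =
      L2dot mu (Pt (W i)) (Pt (W i)).
    by apply: L2dot_ae_eq => //; exact: PtL.
  exact: HS_operator_bounded.
apply: cvg_EFin; first by apply: nearW => i; rewrite Lnorm2E.
have -> : fine \o (fun i => 'N[mu]_2%:E[EFin \o (K (u (s i)) \- Pt v)%R])%E =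
    (fun i => Num.sqrt (L2dot mu (K (u (s i)) \- Pt v) (K (u (s i)) \- Pt v))).
  by apply/funext => i /=; rewrite Lnorm2E.
rewrite -[X in _ --> X]sqrtr0.
apply: cvg_comp; last exact: sqrt_continuous.
apply: (@squeeze_cvgr _ _ _ _ (cst 0) (fun i =>
  HS_norm2 nu mu (fun z x => phi x z) * L2dot nu (W i) (W i))).
- by apply: nearW => i; rewrite L2dot_ge0 D_le.
- exact: cvg_cst.
- rewrite -[X in _ --> X](mulr0 (HS_norm2 nu mu (fun z x => phi x z))).
  by apply: cvgM; [exact: cvg_cst|exact: sv].
Qed.

Let eigen_dot l f g : L2_eigenspace mu K l f -> g \in L2 ->
  L2dot mu (K f) g = l * L2dot mu f g.
Proof.
move=> [fL Kf] gL; have lfL := Lfun2_lin l fL (Lfun2_cst0 mu).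
rewrite -[RHS]addr0 -[X in _ = _ + X](L2dot0l mu g) -L2dot_lin ?Lfun2_cst0//.
apply: L2dot_ae_eql => //; first exact: KL.
by apply: filterS Kf => x /(_ I) -> _; rewrite addr0.
Qed.

Let eigen_orthogonal l l' f g : l != l' -> L2_eigenspace mu K l f ->
  L2_eigenspace mu K l' g -> L2dot mu f g = 0.
Proof.
move=> ll' fl gl; have [[fL _] [gL _]] := (fl, gl).
have := K_self_adjoint fL gL; rewrite (L2dotC mu f (K g)).
rewrite (eigen_dot fl gL) (eigen_dot gl fL) (L2dotC mu g f) => /eqP.
by rewrite -subr_eq0 -mulrBl mulf_eq0 subr_eq0 (negbTE ll') => /eqP.
Qed.

(** The eigenvalue of [e i] is the squared norm of [P (e i)], that is the
    integral over [z] of the squared inner product of [e i] with the section of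
    [phi] at [z]. Bessel's inequality bounds the sum over [i] by the squared
    norm of that section. *)
Let eigen_sum_le (I : finType) (e : I -> T -> R) (l : I -> R) :
  L2_orthonormal mu e -> (forall i, L2_eigenspace mu K (l i) (e i)) ->
  \sum_i l i <= tr.
Proof.
move=> eo eK; have [eL ed] := eo.
have lE i : l i = L2dot nu (P (e i)) (P (e i)).
  by rewrite -K_form// (eigen_dot (eK i))// ed eqxx mulr1.
rewrite -lee_fin -HS_norm2E// -sumEFin.
under eq_bigr do rewrite lE -L2dotE ?PL//.
have mP i : measurable_fun setT (fun z => (P (e i) z ^+ 2)%:E).
  exact/measurable_EFinP/measurable_funX/(Lfun_measurable (PL (eL i))).
rewrite -ge0_integral_sum//; last by move=> i z _; rewrite lee_fin sqr_ge0.
apply: ae_ge0_le_integral => //.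
- by move=> z _; apply: sume_ge0 => i _; rewrite lee_fin sqr_ge0.
- exact: emeasurable_sum.
- by move=> z _; exact: HS_section_norm2_ge0.
- exact: measurable_int (integrable_HS_section_norm2 HS).
apply: filterS (HS_section_Lfun2 HS) => z zL _.
by rewrite /HS_section_norm2 L2dotE// sumEFin lee_fin; exact: bessel.
Qed.

Let eigenspace_lin l : [/\ L2_eigenspace mu K l `<=` [set f | f \in L2],
  L2_eigenspace mu K l (fun=> 0) &
  forall (c : R) f g, L2_eigenspace mu K l f -> L2_eigenspace mu K l g ->
    L2_eigenspace mu K l (fun x => c * f x + g x)].
Proof.
have [_ _ Klin] := K_operator.
have step (c : R) f g : L2_eigenspace mu K l f -> L2_eigenspace mu K l g ->
    L2_eigenspace mu K l (fun x => c * f x + g x).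
  move=> [fL Kf] [gL Kg]; split; first exact: Lfun2_lin.
  apply: filterS3 (Klin c f g fL gL) Kf Kg => x /(_ I) -> /(_ I) -> /(_ I) -> _.
  by ring.
split=> // [f []//|].
split; first exact: Lfun2_cst0.
have z0 := Lfun2_cst0 mu.
apply: filterS (Klin (-1) _ _ z0 z0) => x /(_ I).
have -> : (fun _ : T => -1 * 0 + 0) = (fun=> 0) :> (T -> R).
  by apply/funext => ?; ring.
by move=> -> _; ring.
Qed.

(** By [eigen_sum_le] the size of an orthonormal family of eigenfunctions is at
    most [tr / l], so the supremum defining the multiplicity is attained. *)
Let eigen_multiplicity l : 0 < l -> exists (n : nat) (e : 'I_n -> T -> R),
  [/\ L2_orthonormal mu e, forall i, L2_eigenspace mu K l (e i) &
      L2_multiplicity mu K l = n%:R%:E].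
Proof.
move=> l0; have [WL W0 WD] := eigenspace_lin l.
pose adm n := `[< exists2 e : 'I_n -> T -> R,
  (forall i, L2_eigenspace mu K l (e i)) & L2_free mu e >].
have adm0 : exists n, adm n.
  by exists 0%N; apply/asboolP; exists (fun=> fun=> 0) => [|c _] [].
have adm_le n : adm n -> (n <= Num.truncn (tr / l))%N.
  move=> /asboolP[e We efree].
  have [f fo Wf] := gram_schmidt WL W0 WD We efree.
  have := eigen_sum_le fo Wf; rewrite sumr_const card_ord -mulr_natr => h.
  have nl : n%:R <= tr / l by rewrite ler_pdivlMr// mulrC.
  by rewrite truncn_ge_nat// (le_trans _ nl).
have [n /asboolP[e We efree] nmax] := ex_maxnP adm0 adm_le.
have [f fo Wf] := gram_schmidt WL W0 WD We efree.
exists n, f; split => //; apply/eqP; rewrite eq_le; apply/andP; split.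
  apply: ge_ereal_sup => _ [m mP <-]; rewrite lee_fin ler_nat.
  by apply: nmax; exact/asboolP.
by apply: ereal_sup_ubound; exists n => //; exists e.
Qed.

Let eigenvalue_ge0 l : L2_eigenvalues mu K l -> 0 <= l.
Proof.
move=> [f fl f0]; have [fL _] := fl.
have ff : 0 < L2dot mu f f.
  by rewrite lt0r L2dot_ge0 andbT; apply/eqP => /(L2dot_eq0 fL).
by rewrite -(pmulr_lge0 _ ff) -(eigen_dot fl fL) K_form// L2dot_ge0.
Qed.

(** Orthonormal bases of finitely many eigenspaces form together one orthonormal
    family, indexed by pairs of an eigenvalue and an index in its basis. *)
Let K_summable : summable (L2_eigenvalues mu K)
  (fun l => l%:E * L2_multiplicity mu K l)%E.
Proof.
have eigen l : L2_eigenvalues mu K l -> exists (n : nat) (e : 'I_n -> T -> R),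
    [/\ L2_orthonormal mu e, forall i, L2_eigenspace mu K l (e i) &
        (`|l%:E * L2_multiplicity mu K l| = (l * n%:R)%:E)%E].
  move=> /eigenvalue_ge0; rewrite le_eqVlt => /predU1P[<-|l0].
    exists 0%N, (fun=> fun=> 0); split => [|[]//|].
      by split => -[].
    by rewrite mul0e abse0 mul0r.
  have [n [e [eo We mE]]] := eigen_multiplicity l0.
  exists n, e; split => //.
  by rewrite mE -EFinM gee0_abs// lee_fin mulr_ge0// ltW.
rewrite /summable; apply: (@le_lt_trans _ _ tr%:E); last exact: ltry.
apply: ge_ereal_sup => _ [X [finX XE] <-].
rewrite fsbig_finite//= big_seq_fsetE/=.
have Xeigen (x : fset_set X) : L2_eigenvalues mu K (val x).
  by apply: XE; have := valP x; rewrite in_fset_set// inE.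
pose n x := projT1 (cid (eigen _ (Xeigen x))).
pose e x : 'I_(n x) -> T -> R := projT1 (cid (projT2 (cid (eigen _ (Xeigen x))))).
have eP x : [/\ L2_orthonormal mu (e x),
    forall i, L2_eigenspace mu K (val x) (e x i) &
    (`|(val x)%:E * L2_multiplicity mu K (val x)| = (val x * (n x)%:R)%:E)%E].
  exact: (projT2 (cid (projT2 (cid (eigen _ (Xeigen x)))))).
under eq_bigr => x _ do have [_ _ ->] := eP x.
pose I : finType := {x : fset_set X & 'I_(n x)}.
pose E (i : I) := e (tag i) (tagged i).
have EW i : L2_eigenspace mu K (val (tag i)) (E i) by have [_ + _] := eP (tag i); apply.
have Eo : L2_orthonormal mu E.
  split=> [i|[x i] [x' j]]; first by have [] := EW i.
  have [xx'|xx'] := eqVneq x x'.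
    subst x'; rewrite eq_Tagged/=; have [[_ +] _ _] := eP x; apply.
  rewrite (_ : (_ == _) = false); last by apply/eqP => -[] /eqP; rewrite (negbTE xx').
  apply: eigen_orthogonal (EW _) (EW _) => /=.
  by rewrite (inj_eq val_inj).
rewrite sumEFin lee_fin.
apply: le_trans (eigen_sum_le Eo EW); rewrite le_eqVlt; apply/orP; left.
have := @sig_big_dep R 0 +%R (fset_set X) (fun x => 'I_(n x)) xpredT
  (fun=> xpredT) (fun x _ => val x).
move=> /= <-; apply/eqP; apply: eq_bigr => x _.
by rewrite sumr_const card_ord mulr_natr.
Qed.

Theorem HS_square_trace_class : trace_class mu K.
Proof.
split => // f fL; rewrite K_form//; exact: L2dot_ge0.
Qed.

End hilbert_schmidt_trace_class.

(** * Integration against a density and over Euclidean space *)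

Section integral_density_measure.
Local Open Scope ereal_scope.
Context d (T : measurableType d) (R : realType).
Variables (mu : {measure set T -> \bar R}) (g : T -> \bar R).
Hypothesis g0 : forall x, 0 <= g x.
Hypothesis mg : measurable_fun [set: T] g.
Hypothesis gfin : forall x, g x \is a fin_num.
Local Notation nu := (density_measure mu g0 mg).

Import HBNNSimple.

Lemma ge0_integral_density (f : T -> \bar R) : measurable_fun setT f ->
  (forall x, 0 <= f x) -> \int[nu]_x f x = \int[mu]_x (f x * g x).
Proof.
move=> mf f0; pose f_ := nnsfun_approx measurableT mf.
have mf_ n : measurable_fun setT (fun x => (f_ n x)%:E) by exact/measurable_EFinP.
have nd_f_ x m n : (m <= n)%N -> (f_ m x)%:E <= (f_ n x)%:E.
  by move=> mn; rewrite lee_fin; exact/lefP/nd_nnsfun_approx.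
have cvg_f_ x : (f_ n x)%:E @[n --> \oo] --> f x.
  by apply: cvg_nnsfun_approx.
transitivity (limn (fun n => \int[nu]_x (f_ n x)%:E)).
  rewrite -monotone_convergence//.
  - by apply: eq_integral => x _; exact/esym/cvg_lim.
  - by move=> n x _; rewrite lee_fin.
  - by move=> x _ m n mn; exact: nd_f_.
transitivity (limn (fun n => \int[mu]_x ((f_ n x)%:E * g x))); last first.
  rewrite -monotone_convergence//.
  - apply: eq_integral => x _; apply/cvg_lim => //; exact: cvgeZr.
  - by move=> n; exact: emeasurable_funM.
  - by move=> n x _; rewrite mule_ge0// lee_fin.
  - by move=> x _ m n mn; rewrite lee_wpmul2r//; exact: nd_f_.
congr (limn _); apply/funext => n; set h := f_ n.
have mr r : measurable (h @^-1` [set r]) by [].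
have hE x : (h x)%:E = \sum_(r \in range h) (r%:E * (\1_(h @^-1` [set r]) x)%:E).
  by rewrite fimfunE -fsumEFin.
have indic_ge0 r x : 0 <= r%:E * (\1_(h @^-1` [set r]) x)%:E.
  by rewrite -EFinM nnfun_muleindic_ge0.
have mind r : measurable_fun setT (fun x => r%:E * (\1_(h @^-1` [set r]) x)%:E).
  by apply/measurable_funeM/measurable_EFinP.
rewrite (eq_integral _ _ (fun x _ => hE x)).
rewrite [RHS](eq_integral (fun x => \sum_(r \in range h)
    (r%:E * (\1_(h @^-1` [set r]) x)%:E * g x))); last first.
  by move=> x _; rewrite hE ge0_mule_fsuml.
rewrite !ge0_integral_fsum//; last 2 first.
- by move=> r; exact: emeasurable_funM.
- by move=> r x _; rewrite mule_ge0.
apply: eq_fsbigr => r /[!inE] -[x _ hx].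
have r0 : 0 <= r%:E by rewrite lee_fin -hx.
under [RHS]eq_integral do rewrite -muleA.
rewrite !ge0_integralZl//; last 3 first.
- by apply: emeasurable_funM => //; exact/measurable_EFinP.
- by move=> y _; rewrite mule_ge0// lee_fin.
- exact/measurable_EFinP.
congr (_ * _); rewrite integral_indic// setIT.
under [RHS]eq_integral do rewrite muleC.
by rewrite /= /density_measure integral_mkcond epatch_indic.
Qed.

Lemma integral_density (f : T -> \bar R) : measurable_fun setT f ->
  \int[nu]_x f x = \int[mu]_x (f x * g x).
Proof.
move=> mf; rewrite [LHS]integralE [RHS]integralE.
rewrite !ge0_integral_density//; last 2 first.
- exact: measurable_funeneg.
- exact: measurable_funepos.
congr (_ - _); apply: eq_integral => x _.
- rewrite !funeposE; have [f0|f0] := leP 0 (f x).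
    by rewrite !max_l// mule_ge0.
  by rewrite !max_r ?mul0e// ?mule_le0_ge0// ltW.
- rewrite !funenegE -mulNe; have [f0|f0] := leP 0 (- f x).
    by rewrite !max_l// mule_ge0.
  by rewrite !max_r ?mul0e// ?mule_le0_ge0// ltW.
Qed.

Lemma integrable_density (f : T -> \bar R) : measurable_fun setT f ->
  nu.-integrable setT f -> mu.-integrable setT (fun x => f x * g x).
Proof.
move=> mf /integrableP[_]; rewrite ge0_integral_density//; last exact: measurableT_comp.
move=> fin; apply/integrableP; split; first exact: emeasurable_funM.
by under eq_integral do rewrite abseM (gee0_abs (g0 _)).
Qed.

End integral_density_measure.

Section sigma_finite_product.
Local Open Scope ereal_scope.
Context d1 d2 (T1 : measurableType d1) (T2 : measurableType d2) (R : realType).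
Variables (m1 : {sigma_finite_measure set T1 -> \bar R})
  (m2 : {sigma_finite_measure set T2 -> \bar R}).

(** An alias of [m1 \x m2] that carries the structure of a sigma-finite
    measure. *)
Definition product_sfm : set (T1 * T2) -> \bar R := m1 \x m2.

HB.instance Definition _ := Measure.on product_sfm.

Let product_sfm_sigma_finite : sigma_finite setT product_sfm.
Proof.
have /sigma_finiteP[F [TF ndF F_fin]] := sigma_finiteT m1.
have /sigma_finiteP[G [TG ndG G_fin]] := sigma_finiteT m2.
exists (fun k => F k `*` G k) => [|k].
  apply/seteqP; split => // -[x z] _.
  have [i _ Fx] : (\bigcup_i F i) x by rewrite -TF.
  have [j _ Gz] : (\bigcup_i G i) z by rewrite -TG.
  exists (maxn i j) => //; split => /=.
    by move: Fx; exact/subsetPset/ndF/leq_maxl.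
  by move: Gz; exact/subsetPset/ndG/leq_maxr.
have [[mF F_lt] [mG G_lt]] := (F_fin k, G_fin k); split; first exact: measurableX.
by rewrite /product_sfm product_measure1E// lte_mul_pinfty// ge0_fin_numE.
Qed.

HB.instance Definition _ := Measure_isSigmaFinite.Build _ _ _ product_sfm
  product_sfm_sigma_finite.

End sigma_finite_product.

Section euclidean_integral.
Local Open Scope ereal_scope.
Context {R : realType}.
Local Notation lam := (@lebesgue_measure_n R).

Lemma integral_lebesgue_measure_n_prod n (g : 'I_n -> R -> R) :
  (forall i, measurable_fun setT (g i)) -> (forall i x, (0 <= g i x)%R) ->
  \int[lam n]_t (\prod_(i < n) g i (tnth t i))%:E =
  \prod_(i < n) \int[lebesgue_measure]_x (g i x)%:E.
Proof.
elim: n g => [|n IH] g mg g0.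
  under eq_integral do rewrite big_ord0.
  by rewrite big_ord0 /= integral_cst// mul1e /= /lebesgue_0 diracE mem_set.
have mprod : measurable_fun setT (fun t : euclidean R n.+1 =>
    (\prod_(i < n.+1) g i (tnth t i))%:E).
  apply/measurable_EFinP; apply: measurable_prod => i _.
  exact: measurableT_comp (mg i) (@measurable_tnth _ _ _ i).
have mprod' : measurable_fun setT (fun t : euclidean R n =>
    (\prod_(i < n) g (lift ord0 i) (tnth t i))%:E).
  apply/measurable_EFinP; apply: measurable_prod => i _.
  exact: measurableT_comp (mg _) (@measurable_tnth _ _ _ i).
have prod0 m (h : 'I_m -> R -> R) t : (forall i x, (0 <= h i x)%R) ->
    0 <= (\prod_(i < m) h i (tnth t i))%:E.
  by move=> h0; rewrite lee_fin prodr_ge0.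
rewrite big_ord_recl -IH//= ge0_integral_pushforward//=; last 2 first.
- exact: measurable_cons_tuple_pair.
- by move=> t _; exact: prod0.
rewrite preimage_setT fubini_tonelli1//; last 2 first.
- exact: measurableT_comp mprod (@measurable_cons_tuple_pair _ _).
- by move=> p; exact: prod0.
rewrite /fubini_F /=.
rewrite -ge0_integralZr//; last 3 first.
- by apply/measurable_EFinP; exact: mg.
- by move=> x _; rewrite lee_fin.
- by apply: integral_ge0 => t _; exact: (prod0 _ (fun i => g (lift ord0 i))).
apply: eq_integral => x _; rewrite -ge0_integralZl//; last 2 first.
- by move=> t _; exact: (prod0 _ (fun i => g (lift ord0 i))).
- by rewrite lee_fin.
apply: eq_integral => t _; rewrite -EFinM big_ord_recl; congr (_ * _)%:E%R.
by apply: eq_bigr => i _; rewrite tnthS.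
Qed.

(** With [integral_gt0], this makes the normalizing constant of the posterior
    nonzero. *)
Lemma lebesgue_measure_n_setT n : 0 < lam n setT.
Proof.
pose A (i : 'I_n) : set R := `[0%R, 1%R]%classic.
apply: (@lt_le_trans _ _ (lam n [set t | forall i, A i (tnth t i)])).
  rewrite (@lebesgue_measure_n_box _ _ A); last by move=> i; exact: measurable_itv.
  rewrite big1//= => i _.
  by rewrite lebesgue_measure_itv/= lte_fin ltr01 -EFinB subr0.
apply: le_measure; rewrite ?inE//.
rewrite (_ : [set t | _] = \bigcap_(i in [set: 'I_n])
      ((fun t : euclidean R n => tnth t i) @^-1` A i)).
  apply: fin_bigcap_measurable => [|i _]; first exact: finite_finset.
  by rewrite -[X in measurable X]setTI; apply: measurable_tnth => //; exact: measurable_itv.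
by apply/seteqP; split => /= t At i; [move=> _|]; exact: At.
Qed.

Lemma integral_gt0 d (T : measurableType d) (mu : {measure set T -> \bar R})
  (f : T -> \bar R) : measurable_fun setT f -> (forall x, 0 < f x) ->
  0 < mu setT -> 0 < \int[mu]_x f x.
Proof.
move=> mf f0 muT; rewrite lt0e integral_ge0 ?andbT; last by move=> x _; exact: ltW.
apply/eqP => f_eq0.
have : \int[mu]_x `|f x| = 0.
  by under eq_integral do rewrite gee0_abs ?ltW//.
move/(ae_eq_integral_abs mu measurableT mf) => [N [mN N0 subN]].
have TN : setT `<=` N.
  by move=> x _; apply: subN => /= /(_ I) fx; have := f0 x; rewrite fx ltxx.
have : mu setT <= mu N by apply: le_measure; rewrite ?inE.
by rewrite N0 leNgt muT.
Qed.

End euclidean_integral.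

(** * The inverse gamma distribution *)

Section inverse_gamma_bounds.
Context {R : realType}.
Implicit Types (a b t x : R).

Lemma measurable_inv : measurable_fun setT (fun x : R => x^-1).
Proof.
have -> : (fun x : R => x^-1) = (fun x => x * (x ^+ 2) `^ (-1)).
  apply/funext => x; have [->|x0] := eqVneq x 0; first by rewrite invr0 mul0r.
  rewrite powR_inv1 ?sqr_ge0// expr2 invfM mulrA divff// mul1r//.
apply: measurable_funM => //.
by apply: (measurableT_comp (measurable_powR _)); exact: measurable_funX.
Qed.

Lemma exprn_le_expR x k : 0 <= x -> x ^+ k <= k`!%:R * expR x.
Proof.
case: k => [|k] x0; first by rewrite expr0 mul1r; have := expR_ge1Dx x; lra.
have := expR_ge1Dxn k x0; rewrite -ler_pdivrMl ?ltr0n ?fact_gt0// mulrC; lra.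
Qed.

Lemma integral_oneDsqrV_lty : (\int[lebesgue_measure]_x ((1 + x ^+ 2)^-1 : R)%:E < +oo)%E.
Proof.
rewrite ge0_symfun_integralT.
- rewrite (_ : [set x : R | 0 <= x] = `[0, +oo[%classic); last first.
    by apply/seteqP; split => x /=; rewrite in_itv/= andbT.
  by have := @integral0y_oneDsqr R; rewrite /oneDsqr => ->; rewrite ltry.
- by move=> x; rewrite invr_ge0 addr_ge0 ?sqr_ge0.
- exact: continuous_oneDsqrV.
- by move=> x /=; rewrite sqrrN.
Qed.

Lemma measurable_inverse_gamma_fun a b :
  measurable_fun setT (inverse_gamma_fun a b : R -> R).
Proof.
apply: measurable_funM; first exact: measurable_powR.
by apply: measurableT_comp => //; apply: measurable_funM => //; exact: measurable_inv.
Qed.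

Lemma inverse_gamma_fun_ge0 a b x : 0 <= inverse_gamma_fun a b x.
Proof. by rewrite mulr_ge0 ?powR_ge0 ?expR_ge0. Qed.

(** For [t >= 1] the exponent [- a - 1] is at most [-2]. For [t < 1] the
    exponential beats the power: [t^-1 ^+ N] is at most a multiple of
    [expR (b / t)]. *)
Lemma inverse_gamma_fun_le a b : 1 <= a -> 0 < b ->
  exists C, forall t, 0 < t -> inverse_gamma_fun a b t <= C * (1 + t ^+ 2)^-1.
Proof.
move=> a1 b0; pose N := (Num.truncn (a + 1)).+1.
have aN : a + 1 <= N%:R by apply/ltW; rewrite truncnS_gt.
pose D : R := N`!%:R / b ^+ N; have D0 : 0 <= D by rewrite divr_ge0// exprn_ge0 ?ltW.
exists (2 * (1 + D)) => t t0; rewrite /inverse_gamma_fun.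
have -> : - a - 1 = - (a + 1) by ring.
have t2 := sqr_ge0 t; have d0 : 0 < 1 + t ^+ 2 by rewrite ltr_wpDr.
have [t1|t1] := leP 1 t.
  have e1 : expR (- b / t) <= 1.
    by rewrite -expR0 ler_expR mulNr oppr_le0 divr_ge0 ?ltW.
  have p1 : t `^ (- (a + 1)) <= (t ^+ 2)^-1.
    rewrite powRN lef_pV2 ?posrE ?powR_gt0 ?exprn_gt0// -(powR_mulrn 2 (ltW t0))//.
    by apply: (ler_powR t1); lra.
  apply: (@le_trans _ _ ((t ^+ 2)^-1)).
    by rewrite -[leRHS]mulr1 ler_pM ?powR_ge0 ?expR_ge0.
  rewrite ler_pdivlMr// mulrC ler_pdivrMr ?exprn_gt0//; nra.
have p1 : t `^ (- (a + 1)) <= t^-1 ^+ N.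
  rewrite exprVn -(powR_invn N (ltW t0)).
  by apply: ger_powR; [rewrite t0 (ltW t1)|rewrite lerN2].
have p2 : t^-1 ^+ N <= D * expR (b / t).
  have := @exprn_le_expR (b / t) N (divr_ge0 (ltW b0) (ltW t0)).
  by rewrite exprMn mulrC -ler_pdivlMr ?exprn_gt0// mulrAC.
apply: (@le_trans _ _ D).
  rewrite mulNr expRN ler_pdivrMr ?expR_gt0//; exact: le_trans p1 p2.
have t21 : t ^+ 2 <= 1 by rewrite exprn_ile1 ?ltW.
rewrite ler_pdivlMr//; have := ler_wpM2l D0 t21; lra.
Qed.

(** This is [Gamma(a) / b ^ a]. *)
Definition inverse_gamma_mass a b : R :=
  \int[lebesgue_measure]_(t in `]0, +oo[) inverse_gamma_fun a b t.

Section finite_mass.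
Variables (a b : R).
Hypotheses (a1 : 1 <= a) (b0 : 0 < b).

Lemma integrable_inverse_gamma_fun :
  lebesgue_measure.-integrable `]0, +oo[ (fun t => (inverse_gamma_fun a b t)%:E).
Proof.
have [C C_ge] := inverse_gamma_fun_le a1 b0.
apply/integrableP; split.
  apply/measurable_EFinP/measurable_funTS; exact: measurable_inverse_gamma_fun.
have C0 : 0 <= C.
  have := le_trans (inverse_gamma_fun_ge0 _ _ _) (C_ge 1 ltr01).
  by rewrite pmulr_lge0// invr_gt0 addr_gt0// exprn_gt0.
have moD : measurable_fun setT (fun t : R => ((1 + t ^+ 2)^-1)%:E).
  by apply/measurable_EFinP; apply: continuous_measurable_fun; exact: continuous_oneDsqrV.
have oD0 (t : R) : 0 <= (1 + t ^+ 2)^-1 by rewrite invr_ge0 addr_ge0 ?sqr_ge0.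
apply: (@le_lt_trans _ _ (\int[lebesgue_measure]_(t in `]0%R, +oo[)
    (C%:E * ((1 + t ^+ 2)^-1)%:E))%E).
  apply: ge0_le_integral => //.
  - apply: measurableT_comp => //; apply/measurable_EFinP/measurable_funTS.
    exact: measurable_inverse_gamma_fun.
  - exact/measurable_funTS/measurable_funeM.
  - move=> t /=; rewrite in_itv/= andbT => t0; rewrite lee_fin.
    by rewrite ger0_norm ?inverse_gamma_fun_ge0// C_ge.
apply: (@le_lt_trans _ _ (\int[lebesgue_measure]_t
    (C%:E * ((1 + t ^+ 2)^-1)%:E))%E).
  apply: ge0_subset_integral => //; first exact: measurable_funeM.
  by move=> t _; rewrite mule_ge0 ?lee_fin.
rewrite ge0_integralZl//; last by move=> t _; rewrite lee_fin.
by rewrite lte_mul_pinfty// ?lee_fin// integral_oneDsqrV_lty.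
Qed.

Lemma inverse_gamma_massE : (\int[lebesgue_measure]_(t in `]0%R, +oo[)
  (inverse_gamma_fun a b t)%:E = (inverse_gamma_mass a b)%:E)%E.
Proof.
rewrite /inverse_gamma_mass /Rintegral fineK//; apply: integrable_fin_num => //.
exact: integrable_inverse_gamma_fun.
Qed.

(** On [[b, b + 1]] the integrand is at least [(1 + b) `^ (- a - 1) / e]; this
    avoids evaluating the Gamma function. *)
Lemma inverse_gamma_mass_ge (N : nat) : a + 1 <= N%:R ->
  ((1 + b) ^+ N)^-1 * expR (-1) <= inverse_gamma_mass a b.
Proof.
move=> aN; pose c := ((1 + b) ^+ N)^-1 * expR (-1).
have b1 : 0 < 1 + b by rewrite addr_gt0.
have c0 : 0 <= c by rewrite mulr_ge0 ?expR_ge0// invr_ge0 exprn_ge0// ltW.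
rewrite -lee_fin -inverse_gamma_massE.
have mig : measurable_fun setT (fun t : R => (inverse_gamma_fun a b t)%:E).
  by apply/measurable_EFinP; exact: measurable_inverse_gamma_fun.
apply: (@le_trans _ _ (\int[lebesgue_measure]_(t in `[b, (b + 1)%R])
    (inverse_gamma_fun a b t)%:E)%E); last first.
  apply: ge0_subset_integral => //.
  - exact: measurable_funTS.
  - by move=> t _; rewrite lee_fin inverse_gamma_fun_ge0.
  - by move=> t /=; rewrite !in_itv/= andbT => /andP[bt _]; exact: lt_le_trans bt.
apply: (@le_trans _ _ (\int[lebesgue_measure]_(t in `[b, (b + 1)%R]) (cst c%:E t))%E).
  rewrite integral_cst//= lebesgue_measure_itv/= lte_fin ltrDl ltr01 -EFinB.
  by rewrite addrAC subrr add0r mule1.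
apply: ge0_le_integral => //; first exact: measurable_funTS.
move=> t /=; rewrite in_itv/= => /andP[bt tb]; rewrite lee_fin /inverse_gamma_fun.
have t0 : 0 < t by exact: lt_le_trans bt.
rewrite ler_pM ?expR_ge0 ?invr_ge0 ?exprn_ge0 ?(ltW b1)//.
  have -> : - a - 1 = - (a + 1) by ring.
  rewrite powRN lef_pV2 ?posrE ?powR_gt0 ?exprn_gt0// -(powR_mulrn N (ltW b1)).
  apply: (@le_trans _ _ ((1 + b) `^ (a + 1))); last first.
    by apply: ler_powR; [rewrite lerDl ltW|exact: aN].
  apply: ge0_ler_powR; rewrite ?nnegrE.
  - by rewrite addr_ge0// (le_trans ler01 a1).
  - exact: ltW.
  - exact: ltW.
  - by rewrite addrC.
by rewrite ler_expR mulNr lerN2 ler_pdivrMr// mul1r.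
Qed.

Lemma inverse_gamma_mass_gt0 : 0 < inverse_gamma_mass a b.
Proof.
have aN : a + 1 <= (Num.truncn (a + 1)).+1%:R by apply/ltW; rewrite truncnS_gt.
apply: lt_le_trans (inverse_gamma_mass_ge aN).
by rewrite mulr_gt0 ?expR_gt0// invr_gt0 exprn_gt0// addr_gt0.
Qed.

End finite_mass.

Lemma normal_var_pdfE (m v x : R) : 0 < v ->
  normal_var_pdf m v x =
    (Num.sqrt (2 * pi * v))^-1 * expR (- ((2 * v)^-1 * (x - m) ^+ 2)).
Proof.
move=> v0; rewrite /normal_var_pdf normal_pdfE ?gt_eqF ?sqrtr_gt0//.
rewrite /normal_peak /normal_fun sqr_sqrtr ?ltW//; congr (_^-1 * expR _).
  by congr Num.sqrt; rewrite -mulr_natl; ring.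
by rewrite -mulr_natl; field; rewrite gt_eqF.
Qed.

End inverse_gamma_bounds.

(** * The hierarchical model *)

Section hierarchical_model_formulas.
Context {R : realType} (n : nat).
Variables (y : n.-tuple R) (V a b : R).
Hypotheses (V0 : 0 < V) (a0 : 0 < a) (b0 : 0 < b) (n3 : (3 <= n)%N).
Implicit Types (theta : euclidean R n) (m A : R).

Local Notation mean := (@tuple_mean R n).

Let n_gt0 : 0 < n%:R :> R.
Proof. by rewrite ltr0n (leq_trans _ n3). Qed.

Definition deviation (t : euclidean R n) : R :=
  \sum_(i < n) (tnth t i - tuple_mean t) ^+ 2.

Definition residual theta : R := \sum_(i < n) (tnth y i - tnth theta i) ^+ 2.

Definition ig_shape : R := a + (n%:R - 1) / 2.

Definition ig_scale theta : R := b + 2^-1 * deviation theta.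

Lemma deviation_ge0 t : 0 <= deviation t.
Proof. by apply: sumr_ge0 => i _; exact: sqr_ge0. Qed.

Lemma residual_ge0 theta : 0 <= residual theta.
Proof. by apply: sumr_ge0 => i _; exact: sqr_ge0. Qed.

Lemma ig_shape_ge1 : 1 <= ig_shape.
Proof.
have : 3 <= n%:R :> R by rewrite (ler_nat R 3).
by rewrite /ig_shape; move: a0; lra.
Qed.

Lemma ig_scale_gt0 theta : 0 < ig_scale theta.
Proof. by rewrite ltr_wpDr// mulr_ge0// deviation_ge0. Qed.

Lemma sum_sqr_sub (t : euclidean R n) c :
  \sum_(i < n) (tnth t i - c) ^+ 2 = deviation t + n%:R * (tuple_mean t - c) ^+ 2.
Proof.
have sumE : \sum_(i < n) tnth t i = n%:R * tuple_mean t.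
  by rewrite /tuple_mean mulrA divff ?gt_eqF// mul1r.
have expand d : \sum_(i < n) (tnth t i - d) ^+ 2 =
    \sum_(i < n) tnth t i ^+ 2 - 2 * d * (n%:R * tuple_mean t) + n%:R * d ^+ 2.
  transitivity (\sum_(i < n) (tnth t i ^+ 2 - 2 * d * tnth t i + d ^+ 2)).
    by apply: eq_bigr => i _; ring.
  by rewrite !big_split/= sumr_const card_ord sumrN -mulr_sumr sumE
    -[d ^+ 2 *+ n]mulr_natl.
rewrite /deviation !expand; ring.
Qed.

(** The marginal of [unnormalized_posterior] in [theta]. *)
Definition theta_weight theta : R :=
  Num.sqrt (2 * pi / n%:R) * expR (- (2 * V)^-1 * residual theta) *
  inverse_gamma_mass ig_shape (ig_scale theta).

Lemma theta_weight_gt0 theta : 0 < theta_weight theta.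
Proof.
rewrite !mulr_gt0 ?expR_gt0//.
  by rewrite sqrtr_gt0 divr_gt0// mulr_gt0 ?pi_gt0.
exact: inverse_gamma_mass_gt0 ig_shape_ge1 (ig_scale_gt0 theta).
Qed.

Lemma cond_mu_AE theta m A : 0 < A ->
  cond_mu_A a b theta m A =
    inverse_gamma_fun ig_shape (ig_scale theta) A /
      inverse_gamma_mass ig_shape (ig_scale theta) *
    normal_var_pdf (mean theta) (A / n%:R) m.
Proof. by move=> A0; rewrite /cond_mu_A /inverse_gamma_pdf A0. Qed.

(** Bayes' formula for [(m, A)] given [theta]: the Gaussian integral in [m]
    contributes a factor [A `^ 2^-1], which turns the exponent
    [- a - 1 - n / 2] of the prior and likelihood into [- ig_shape - 1]. *)
Lemma posterior_cond_mu_A theta m A : 0 < A ->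
  unnormalized_posterior y V a b theta m A =
  theta_weight theta * cond_mu_A a b theta m A.
Proof.
move=> A0; rewrite cond_mu_AE// normal_var_pdfE ?divr_gt0//.
rewrite /theta_weight /unnormalized_posterior /inverse_gamma_fun.
set I := inverse_gamma_mass _ _.
have I0 : I != 0.
  by rewrite gt_eqF// inverse_gamma_mass_gt0 ?ig_shape_ge1 ?ig_scale_gt0.
have pn0 : 0 < 2 * pi / n%:R :> R by rewrite divr_gt0// mulr_gt0 ?pi_gt0.
have sqrtE : Num.sqrt (2 * pi * (A / n%:R)) = Num.sqrt (2 * pi / n%:R) * A `^ 2^-1.
  by rewrite powR12_sqrt ?(ltW A0)// -sqrtrM ?(ltW pn0)//; congr Num.sqrt; ring.
have powE : A `^ (- a - 1 - n%:R / 2) = A `^ (- ig_shape - 1) * (A `^ 2^-1)^-1.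
  rewrite -powRN -powRD; last by rewrite (gt_eqF A0) implybT.
  by congr (_ `^ _); rewrite /ig_shape; field.
rewrite powE sqrtE sum_sqr_sub -/(residual theta) /ig_scale.
have -> : - (2 * A)^-1 * (deviation theta + n%:R * (mean theta - m) ^+ 2)
    - (2 * V)^-1 * residual theta = - (2 * V)^-1 * residual theta +
    (- (2^-1 * deviation theta) / A + - ((2 * (A / n%:R))^-1 * (m - mean theta) ^+ 2)).
  by field; rewrite !gt_eqF.
have -> : - (b + 2^-1 * deviation theta) / A =
  - b / A + (- (2^-1 * deviation theta) / A) by field; rewrite gt_eqF.
rewrite !expRD; field.
by rewrite I0 !gt_eqF ?powR_gt0 ?sqrtr_gt0.
Qed.

Lemma integral_cond_mu_A theta A : 0 < A ->
  (\int[lebesgue_measure]_m (cond_mu_A a b theta m A)%:E =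
  (inverse_gamma_fun ig_shape (ig_scale theta) A /
      inverse_gamma_mass ig_shape (ig_scale theta))%:E)%E.
Proof.
move=> A0; under eq_integral do rewrite cond_mu_AE// EFinM.
rewrite ge0_integralZl//.
- by rewrite integral_normal_pdf mule1.
- by apply/measurable_EFinP; exact: measurable_normal_pdf.
- by move=> m _; rewrite lee_fin normal_pdf_ge0.
rewrite lee_fin divr_ge0 ?inverse_gamma_fun_ge0//.
exact/ltW/(inverse_gamma_mass_gt0 ig_shape_ge1 (ig_scale_gt0 theta)).
Qed.

Lemma unnormalized_marginalE theta :
  unnormalized_marginal y V a b theta = (theta_weight theta)%:E.
Proof.
rewrite /unnormalized_marginal.
have I0 := inverse_gamma_mass_gt0 ig_shape_ge1 (ig_scale_gt0 theta).
transitivity (\int[lebesgue_measure]_(A in `]0%R, +oo[)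
   ((theta_weight theta / inverse_gamma_mass ig_shape (ig_scale theta))%:E *
    (inverse_gamma_fun ig_shape (ig_scale theta) A)%:E))%E.
  apply: eq_integral => A; rewrite inE/= in_itv/= andbT => A0.
  under eq_integral do rewrite posterior_cond_mu_A// EFinM.
  rewrite ge0_integralZl//.
  - by rewrite integral_cond_mu_A// -!EFinM; congr EFin; ring.
  - apply/measurable_EFinP; under eq_fun do rewrite cond_mu_AE//.
    by apply: measurable_funM => //; exact: measurable_normal_pdf.
  - move=> m _; rewrite lee_fin cond_mu_AE// mulr_ge0 ?normal_pdf_ge0//.
    by rewrite divr_ge0 ?inverse_gamma_fun_ge0 ?(ltW I0).
  - by rewrite lee_fin ltW ?theta_weight_gt0.
rewrite ge0_integralZl//.
- rewrite inverse_gamma_massE ?ig_shape_ge1 ?ig_scale_gt0// -EFinM divfK//.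
  by rewrite gt_eqF.
- apply/measurable_EFinP/measurable_funTS; exact: measurable_inverse_gamma_fun.
- by move=> A _; rewrite lee_fin inverse_gamma_fun_ge0.
- by rewrite lee_fin divr_ge0// ltW// theta_weight_gt0.
Qed.

(** The marginal of [unnormalized_posterior] in [(m, A)]. *)
Definition hyper_weight m A : R :=
  A `^ (- a - 1 - n%:R / 2) * expR (- b / A) *
  expR (- (2 * (A + V))^-1 * \sum_(i < n) (tnth y i - m) ^+ 2) *
  Num.sqrt (2 * pi * (A * V / (A + V))) ^+ n.

Lemma hyper_weight_gt0 m A : 0 < A -> 0 < hyper_weight m A.
Proof.
move=> A0; rewrite !mulr_gt0 ?expR_gt0 ?powR_gt0// exprn_gt0// sqrtr_gt0.
by rewrite !mulr_gt0 ?pi_gt0// invr_gt0 addr_gt0.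
Qed.

(** For each [i], the square in [cond_theta] completes the sum of the two
    squares of [unnormalized_posterior] that involve [tnth theta i]; the remainder
    is the square of [tnth y i - m]. *)
Lemma cond_thetaE m A theta : 0 < A ->
  cond_theta y V m A theta =
    (Num.sqrt (2 * pi * (A * V / (A + V))) ^+ n)^-1 *
    expR (- (2 * A)^-1 * (\sum_(i < n) (tnth theta i - m) ^+ 2)
      - (2 * V)^-1 * residual theta
      + (2 * (A + V))^-1 * \sum_(i < n) (tnth y i - m) ^+ 2).
Proof.
move=> A0; have AV0 : 0 < A + V by rewrite addr_gt0.
rewrite /cond_theta /residual !mulr_sumr -sumrB -big_split/= expR_sum.
rewrite -exprVn -[in X in _ ^-1 ^+ X](card_ord n) -prodr_const -big_split/=.
apply: eq_bigr => i _; rewrite normal_var_pdfE ?divr_gt0 ?mulr_gt0//.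
by congr (_ * expR _); field; rewrite !gt_eqF.
Qed.

Lemma posterior_cond_theta theta m A : 0 < A ->
  unnormalized_posterior y V a b theta m A =
  hyper_weight m A * cond_theta y V m A theta.
Proof.
move=> A0; have AV0 : 0 < A + V by rewrite addr_gt0.
have s0 : 0 < Num.sqrt (2 * pi * (A * V / (A + V))).
  by rewrite sqrtr_gt0 !mulr_gt0 ?pi_gt0// invr_gt0.
rewrite cond_thetaE// /hyper_weight /unnormalized_posterior -/(residual theta).
rewrite !expRD !mulNr !expRN.
field; by rewrite !gt_eqF ?exprn_gt0 ?expR_gt0.
Qed.

Lemma cond_theta_ge0 m A theta : 0 <= cond_theta y V m A theta.
Proof. by apply: prodr_ge0 => i _; exact: normal_pdf_ge0. Qed.

Lemma cond_mu_A_ge0 m A theta : 0 <= cond_mu_A a b theta m A.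
Proof.
rewrite mulr_ge0 ?normal_pdf_ge0// /inverse_gamma_pdf; case: ifP => // _.
rewrite divr_ge0 ?inverse_gamma_fun_ge0// Rintegral_ge0// => t _.
exact: inverse_gamma_fun_ge0.
Qed.

End hierarchical_model_formulas.

(** * Integrability of the kernel on the diagonal *)

Lemma sqr_add_div_le (R : realFieldType) (p x s t : R) : 0 < s -> 0 < t ->
  (p + x) ^+ 2 / (s + t) <= p ^+ 2 / s + x ^+ 2 / t.
Proof.
move=> s0 t0; have st0 : 0 < s + t by rewrite addr_gt0.
rewrite -subr_ge0 (_ : _ - _ = (p * t - x * s) ^+ 2 / (s * t * (s + t))).
  by rewrite divr_ge0 ?sqr_ge0// !mulr_ge0// ltW.
by field; rewrite !gt_eqF.
Qed.

Section diagonal_bound.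
Context {R : realType} (n : nat).
Variables (y : n.-tuple R) (V a b : R).
Hypotheses (V0 : 0 < V) (a0 : 0 < a) (b0 : 0 < b) (n3 : (3 <= n)%N).
Implicit Types (theta : euclidean R n) (m A : R).

Local Notation mean := (@tuple_mean R n).
Local Notation Syy := (deviation (y : euclidean R n)).

Let n_gt0 : 0 < n%:R :> R.
Proof. by rewrite ltr0n (leq_trans _ n3). Qed.

Lemma residual_mean_le theta :
  n%:R * (mean y - mean theta) ^+ 2 <= residual y theta.
Proof.
pose t : euclidean R n := [tuple tnth y i - tnth theta i | i < n].
have -> : residual y theta = \sum_(i < n) (tnth t i - 0) ^+ 2.
  by apply: eq_bigr => i _; rewrite tnth_mktuple subr0.
rewrite (sum_sqr_sub n3) (_ : mean y - mean theta = mean t - 0).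
  by rewrite lerDr deviation_ge0.
rewrite subr0 /tuple_mean -mulrBr -sumrB; congr (_ * _).
by apply: eq_bigr => i _; rewrite tnth_mktuple.
Qed.

Lemma deviation_le_residual theta :
  2^-1 * deviation theta <= residual y theta + Syy.
Proof.
have := sum_sqr_sub n3 theta (mean y).
have := sqr_ge0 (mean theta - mean y).
suff : \sum_(i < n) (tnth theta i - mean y) ^+ 2 <= 2 * (residual y theta + Syy).
  by have := n_gt0; nra.
rewrite mulrDr /residual /deviation !mulr_sumr -big_split/=; apply: ler_sum => i _.
have := sqr_ge0 (tnth y i - tnth theta i + (tnth y i - mean y)); nra.
Qed.

(** The rate at which the integrand decays in [theta]; it degenerates as [A]
    tends to [0], where the factor [expR (- b / A)] takes over. *)
Definition decay_rate A : R := A / (2 * V * (3 * V + A)).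

(** The dangerous term is [n * (mean y - m) ^+ 2 / (2 * (A + V))], which is
    positive. It is split between [mean y - mean theta] and [mean theta - m],
    with weights [V + A / 3] and [2 * A / 3]. The first part is less than the
    available [residual y theta / (2 * V)]; the second is three quarters of the
    available [n * (mean theta - m) ^+ 2 / A], because both conditional densities
    contribute such a square. *)
Lemma exponent_le theta m A : 0 < A ->
  - (2 * A)^-1 * (\sum_(i < n) (tnth theta i - m) ^+ 2)
    - (2 * V)^-1 * residual y theta
    + (2 * (A + V))^-1 * (\sum_(i < n) (tnth y i - m) ^+ 2)
    - ig_scale b theta / A - (2 * (A / n%:R))^-1 * (m - mean theta) ^+ 2 <=
  (2 * V)^-1 * Syy - b / A - decay_rate A * residual y theta
    - (2 * (2 * A / n%:R))^-1 * (m - mean theta) ^+ 2.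
Proof.
move=> A0; rewrite (sum_sqr_sub n3) (@sum_sqr_sub _ _ n3 (y : euclidean R n)).
rewrite /ig_scale /decay_rate.
have S0 := deviation_ge0 theta; have Sy0 := deviation_ge0 (y : euclidean R n).
have q_le := residual_mean_le theta.
set S := deviation theta in S0 *; set Sy := deviation (y : euclidean R n) in Sy0 *.
set q := residual y theta in q_le *.
pose X := mean theta - m; pose P := mean y - mean theta.
have -> : mean y - m = P + X by rewrite /P /X; ring.
have -> : m - mean theta = - X by rewrite /X; ring.
rewrite -/P in q_le; rewrite -/X sqrrN.
have V3A : 0 < 3 * V + A by rewrite addr_gt0// mulr_gt0.
have AV0 : 0 < A + V by rewrite addr_gt0.
have split_le : (P + X) ^+ 2 / (A + V) <= P ^+ 2 / (V + A / 3) + X ^+ 2 / (2 * A / 3).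
  rewrite (_ : A + V = (V + A / 3) + 2 * A / 3); last by field.
  by apply: sqr_add_div_le; rewrite ?addr_gt0 ?divr_gt0// mulr_gt0.
have h1 : (2 * (A + V))^-1 * Sy <= (2 * V)^-1 * Sy.
  by rewrite ler_wpM2r// lef_pV2 ?posrE ?mulr_gt0// ler_pM2l// lerDr ltW.
have h2 : (2 * (A + V))^-1 * (n%:R * (P + X) ^+ 2) <=
    3 * (2 * (3 * V + A))^-1 * q + 3 * (4 * A)^-1 * (n%:R * X ^+ 2).
  apply: (@le_trans _ _ (n%:R / 2 * (P ^+ 2 / (V + A / 3) + X ^+ 2 / (2 * A / 3)))).
    rewrite (_ : _ * _ = n%:R / 2 * ((P + X) ^+ 2 / (A + V))).
      by rewrite ler_pM2l ?divr_gt0.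
    by field; rewrite gt_eqF.
  rewrite (_ : _ / 2 * _ = 3 * (2 * (3 * V + A))^-1 * (n%:R * P ^+ 2) +
      3 * (4 * A)^-1 * (n%:R * X ^+ 2)); last first.
    by field; rewrite !gt_eqF//; move: V3A; lra.
  by rewrite lerD2r ler_wpM2l// mulr_ge0// invr_ge0 mulr_ge0 ?(ltW V3A).
have h3 : 0 <= S / A by rewrite divr_ge0 ?(ltW A0).
have e1 : (2 * V)^-1 * q = 3 * (2 * (3 * V + A))^-1 * q + A / (2 * V * (3 * V + A)) * q.
  by field; rewrite !gt_eqF.
have e2 : (2 * A)^-1 * (S + n%:R * X ^+ 2) = S / A / 2 + 2 * (4 * A)^-1 * (n%:R * X ^+ 2).
  by field; rewrite !gt_eqF.
have e3 : (2 * (A / n%:R))^-1 * X ^+ 2 = 2 * (4 * A)^-1 * (n%:R * X ^+ 2).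
  by field; rewrite !gt_eqF.
have e4 : (2 * (2 * A / n%:R))^-1 * X ^+ 2 = (4 * A)^-1 * (n%:R * X ^+ 2).
  by field; rewrite !gt_eqF.
have e5 : (b + 2^-1 * S) / A = b / A + S / A / 2 by field; rewrite gt_eqF.
rewrite mulNr e2 e3 e4 e5 e1 (mulrDr (2 * (A + V))^-1).
move: h1 h2 h3; lra.
Qed.

Definition cauchy_weight theta : R := \prod_(i < n) (1 + tnth theta i ^+ 2)^-1.

Lemma cauchy_weight_ge0 theta : 0 <= cauchy_weight theta.
Proof. by apply: prodr_ge0 => i _; rewrite invr_ge0 addr_ge0 ?sqr_ge0. Qed.

(** [B + residual y theta] is at least [1 + (tnth y i - tnth theta i) ^+ 2] for
    every [i], and this is at least [(1 + tnth theta i ^+ 2) / c i]. *)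
Lemma residual_pow_le : exists2 C, 0 <= C & forall B theta, 1 <= B ->
  ((B + residual y theta) ^+ n)^-1 <= C * cauchy_weight theta.
Proof.
pose c i := 2 * (1 + tnth y i ^+ 2).
have c0 i : 0 < c i by rewrite mulr_gt0// ltr_pwDl// sqr_ge0.
exists (\prod_(i < n) c i) => [|B theta B1]; first by apply: prodr_ge0 => i _; exact: ltW.
rewrite /cauchy_weight -big_split/= -exprVn -[X in _ ^-1 ^+ X](card_ord n) -prodr_const.
have q0 := residual_ge0 y theta.
have Bq0 : 0 < B + residual y theta by rewrite ltr_wpDr// (lt_le_trans ltr01).
apply: ler_prod => i _; rewrite invr_ge0 (ltW Bq0)/=.
have t2 := sqr_ge0 (tnth theta i); have d0 : 0 < 1 + tnth theta i ^+ 2 by rewrite ltr_wpDr.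
rewrite ler_pdivlMr// ler_pdivrMl//.
have qi : (tnth y i - tnth theta i) ^+ 2 <= residual y theta.
  by rewrite /residual (bigD1 i)//= lerDl sumr_ge0// => j _; exact: sqr_ge0.
have := sqr_ge0 (tnth theta i - 2 * tnth y i); rewrite /c.
have : 0 <= (B + residual y theta - 1 - (tnth y i - tnth theta i) ^+ 2) * tnth y i ^+ 2.
  by rewrite mulr_ge0 ?sqr_ge0//; lra.
have : 0 <= (tnth y i - tnth theta i) ^+ 2 * tnth y i ^+ 2 by rewrite mulr_ge0 ?sqr_ge0.
lra.
Qed.

Lemma decay_rate_bounds A : 0 < A ->
  [/\ 0 < decay_rate A, decay_rate A <= (2 * V)^-1 &
      (decay_rate A)^-1 <= 2 * V * (1 + 3 * V) * (1 + A^-1)].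
Proof.
move=> A0; have V3A : 0 < 3 * V + A by rewrite addr_gt0// mulr_gt0.
have V3 : 0 < 3 * V by rewrite mulr_gt0.
rewrite /decay_rate; split.
- by rewrite divr_gt0// !mulr_gt0.
- rewrite invfM mulrCA ler_piMr// ?invr_ge0 ?mulr_ge0 ?(ltW V0)//.
  by rewrite ler_pdivrMr// mul1r lerDr ltW.
- rewrite invf_div -subr_ge0 (_ : _ - _ = 2 * V * (A^-1 + 3 * V)).
    by rewrite !mulr_ge0 ?addr_ge0 ?invr_ge0 ?(ltW A0) ?(ltW V0) ?(ltW V3).
  by field; rewrite gt_eqF.
Qed.

(** With [q := residual y theta] and [r := decay_rate A], a power of [B + q] is
    at most a multiple of the same power of [r^-1] times [expR (r * (B + q))].
    The power [N + n] leaves the factor [(B + q) ^- n], which is integrable in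
    [theta], and powers of [r^-1] are controlled by powers of [1 + A^-1]. *)
Lemma decay_le N : exists2 C, 0 <= C & forall theta A, 0 < A ->
  expR (- (decay_rate A * residual y theta)) * (1 + ig_scale b theta) ^+ N <=
  C * (1 + A^-1) ^+ (N + n) * cauchy_weight theta.
Proof.
have [C C0 C_ge] := residual_pow_le.
pose B := 1 + b + Syy; pose D := 2 * V * (1 + 3 * V); pose k := (N + n)%N.
have B1 : 1 <= B by have := deviation_ge0 (y : euclidean R n); rewrite /B; move: b0; lra.
have D0 : 0 <= D by rewrite !mulr_ge0 ?(ltW V0)// addr_ge0// mulr_ge0 ?(ltW V0).
exists (expR (B / (2 * V)) * k`!%:R * D ^+ k * C) => [|theta A A0].
  by rewrite !mulr_ge0 ?expR_ge0 ?exprn_ge0.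
have [r0 r_le r_ge] := decay_rate_bounds A0.
set r := decay_rate A in r0 r_le r_ge *; set q := residual y theta.
have q0 : 0 <= q := residual_ge0 y theta.
have u0 : 0 < 1 + A^-1 by rewrite addr_gt0// invr_gt0.
have Du0 : 0 <= D * (1 + A^-1) := mulr_ge0 D0 (ltW u0).
have Bq0 : 0 < B + q by rewrite ltr_wpDr// (lt_le_trans ltr01).
have bq : 1 + ig_scale b theta <= B + q.
  by have := deviation_le_residual theta; rewrite /ig_scale /B -/q; lra.
have bN : (1 + ig_scale b theta) ^+ N <= (B + q) ^+ k * ((B + q) ^+ n)^-1.
  rewrite /k exprD mulfK ?expf_neq0 ?gt_eqF// lerXn2r ?nnegrE ?(ltW Bq0)//.
  by apply: addr_ge0 => //; apply/ltW/ig_scale_gt0.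
have ek : (B + q) ^+ k <= k`!%:R * expR (r * (B + q)) * (D * (1 + A^-1)) ^+ k.
  have := exprn_le_expR k (ltW (mulr_gt0 r0 Bq0)).
  rewrite exprMn -ler_pdivlMl ?exprn_gt0// -exprVn => h.
  apply: le_trans h _; rewrite mulrC ler_wpM2l ?mulr_ge0 ?expR_ge0//.
  by apply: lerXn2r r_ge; rewrite ?nnegrE ?invr_ge0 ?(ltW r0).
have eB : expR (r * (B + q)) <= expR (B / (2 * V)) * expR (r * q).
  rewrite mulrDr expRD ler_wpM2r ?expR_ge0// ler_expR mulrC.
  by rewrite ler_wpM2l// (le_trans ler01).
apply: (@le_trans _ _ (expR (- (r * q)) * (k`!%:R *
    (expR (B / (2 * V)) * expR (r * q)) * (D * (1 + A^-1)) ^+ k * (C * cauchy_weight theta)))).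
  rewrite ler_wpM2l ?expR_ge0//; apply: le_trans bN _.
  rewrite ler_pM ?exprn_ge0 ?invr_ge0 ?exprn_ge0 ?(ltW Bq0) ?C_ge//.
  by apply: le_trans ek _; rewrite ler_wpM2r ?exprn_ge0// ler_wpM2l.
rewrite le_eqVlt; apply/orP; left; apply/eqP.
by rewrite expRN exprMn; field; rewrite gt_eqF ?expR_gt0.
Qed.

(** Half of the scale [b] pays for the powers of [1 + A^-1]. *)
Lemma inverse_gamma_absorb k : exists2 C, 0 <= C & forall A, 0 < A ->
  (1 + A^-1) ^+ k * expR (- b / A) <= C * expR (- (b / 2) / A).
Proof.
exists (k`!%:R * (2 / b) ^+ k * expR (b / 2)) => [|A A0].
  by rewrite !mulr_ge0 ?expR_ge0 ?exprn_ge0// divr_ge0 ?(ltW b0).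
have u0 : 0 <= 1 + A^-1 by rewrite addr_ge0 ?invr_ge0 ?(ltW A0).
have x0 : 0 <= b / 2 * (1 + A^-1) by rewrite mulr_ge0// divr_ge0// ltW.
have := exprn_le_expR k x0.
rewrite exprMn -ler_pdivlMl ?exprn_gt0 ?divr_gt0// => h.
have -> : - (b / 2) / A = - b / A + (b / 2) * A^-1 by field; rewrite gt_eqF.
rewrite expRD [leRHS]mulrCA mulrC ler_wpM2l ?expR_ge0//.
apply: le_trans h _; rewrite mulrDr mulr1 expRD -exprVn invf_div.
by rewrite le_eqVlt; apply/orP; left; apply/eqP; ring.
Qed.

Lemma gaussian_peak_le A : 0 < A ->
  (Num.sqrt (2 * pi * (A * V / (A + V))))^-1 <= (1 + V^-1) * (1 + A^-1).
Proof.
move=> A0; have AV0 : 0 < A + V by rewrite addr_gt0.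
have iA : 0 < A^-1 by rewrite invr_gt0.
have iV : 0 < V^-1 by rewrite invr_gt0.
have v0 : 0 < 2 * pi * (A * V / (A + V)) by rewrite !mulr_gt0 ?pi_gt0// invr_gt0.
set u := (1 + V^-1) * (1 + A^-1).
have u1 : 1 <= u by rewrite /u; nra.
have -> : (Num.sqrt (2 * pi * (A * V / (A + V))))^-1 =
    Num.sqrt ((2 * pi)^-1 * (A^-1 + V^-1)).
  have inv_v p : 0 < p -> (2 * p * (A * V / (A + V)))^-1 = (2 * p)^-1 * (A^-1 + V^-1).
    by move=> p0; field; rewrite !gt_eqF.
  by rewrite -sqrtrV ?(ltW v0)// inv_v// pi_gt0.
have u0 : 0 <= u by rewrite (le_trans ler01).
apply: (@le_trans _ _ (Num.sqrt (u ^+ 2))); last by rewrite sqrtr_sqr ger0_norm.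
rewrite ler_sqrt ?exprn_ge0//.
have p1 : (2 * pi)^-1 <= 1 :> R.
  by rewrite invf_le1 ?mulr_gt0 ?pi_gt0//; have := pi_ge2 R; lra.
apply: (@le_trans _ _ (A^-1 + V^-1)); first by rewrite ler_piMl// addr_ge0 ?ltW.
apply: (@le_trans _ _ u); first by rewrite /u; nra.
by rewrite expr2 ler_peMl.
Qed.

(** The bound separates the variables: it is integrable in [m], then in [A], then
    in [theta]. *)
Theorem diagonal_density_le : exists2 C, 0 <= C & forall theta m A, 0 < A ->
  cond_theta y V m A theta * cond_mu_A a b theta m A <=
  C * cauchy_weight theta * inverse_gamma_fun (ig_shape n a) (b / 2) A *
    normal_var_pdf (mean theta) (2 * A / n%:R) m.
Proof.
(* This power makes [I^-1 <= expR 1 * (1 + be) ^+ N] in [inverse_gamma_mass_ge]. *)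
pose al := ig_shape n a; pose N := (Num.truncn (al + 1)).+1.
have aN : al + 1 <= N%:R by apply/ltW; rewrite truncnS_gt.
have [C1 C10 C1_ge] := decay_le N.
have [C2 C20 C2_ge] := inverse_gamma_absorb (n + (N + n)).
pose c := 1 + V^-1; have c0 : 0 <= c by rewrite addr_ge0 ?invr_ge0 ?(ltW V0).
pose eS := expR ((2 * V)^-1 * Syy).
exists (c ^+ n * expR 1 * 2 * eS * C1 * C2) => [|theta m A A0].
  by rewrite !mulr_ge0 ?expR_ge0 ?exprn_ge0.
have An0 : 0 < A / n%:R by rewrite divr_gt0.
have An20 : 0 < 2 * A / n%:R by rewrite divr_gt0 ?mulr_gt0.
have u0 : 0 <= 1 + A^-1 by rewrite addr_ge0 ?invr_ge0 ?(ltW A0).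
rewrite cond_thetaE// cond_mu_AE// !normal_var_pdfE// /inverse_gamma_fun.
have be0 := ig_scale_gt0 b0 theta.
have al1 : 1 <= al := ig_shape_ge1 a0 n3.
have I0 := inverse_gamma_mass_gt0 al1 be0.
set be := ig_scale b theta in be0 I0 *; rewrite -/al; set I := inverse_gamma_mass al be.
set s := Num.sqrt _; set t := Num.sqrt _; set t' := Num.sqrt _.
set E1 := _ - _ + _; set E2 := (2 * (A / n%:R))^-1 * _; set E3 := (2 * (2 * A / n%:R))^-1 * _.
have -> : (s ^+ n)^-1 * expR E1 * (A `^ (- al - 1) * expR (- be / A) / I * (t^-1 * expR (- E2)))
   = s^-1 ^+ n * A `^ (- al - 1) * I^-1 * t^-1 * expR (E1 - be / A - E2).
  by rewrite exprVn mulNr !expRD; ring.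
have s_le : s^-1 ^+ n <= (c * (1 + A^-1)) ^+ n.
  by rewrite lerXn2r ?nnegrE ?invr_ge0 ?sqrtr_ge0 ?mulr_ge0// gaussian_peak_le.
have I_le : I^-1 <= expR 1 * (1 + be) ^+ N.
  have := inverse_gamma_mass_ge al1 be0 aN; rewrite -/I => h.
  have be1 : 0 < expR 1 * (1 + be) ^+ N.
    by rewrite mulr_gt0 ?expR_gt0// exprn_gt0// (lt_trans be0) ?ltrDr.
  rewrite -[leRHS]invrK lef_pV2 ?posrE ?invr_gt0//.
  by apply: le_trans h; rewrite invfM -expRN mulrC.
have t_le : t^-1 <= 2 * t'^-1.
  have t0 : 0 < t by rewrite sqrtr_gt0 mulr_gt0// mulr_gt0 ?pi_gt0.
  have t'0 : 0 < t' by rewrite sqrtr_gt0 mulr_gt0// mulr_gt0 ?pi_gt0.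
  rewrite -[2]invrK -invfM lef_pV2 ?posrE ?mulr_gt0 ?invr_gt0//.
  rewrite ler_pdivrMl// /t -[X in X * _](ger0_norm (ler0n _ 2)) -sqrtr_sqr -sqrtrM ?exprn_ge0//.
  have pA0 : 0 <= pi * (A / n%:R) := mulr_ge0 (pi_ge0 R) (ltW An0).
  rewrite ler_sqrt; last by move: pA0; lra.
  move: pA0.
  by rewrite -(mulrA 2 A); lra.
have E_le : expR (E1 - be / A - E2) <=
    eS * expR (- b / A) * expR (- (decay_rate A * residual y theta)) * expR (- E3).
  rewrite /eS -!expRD ler_expR; have := exponent_le theta m A0.
  by rewrite -/E1 -/be -/E2 -/E3 mulNr; lra.
apply: (@le_trans _ _ ((c * (1 + A^-1)) ^+ n * A `^ (- al - 1) * (expR 1 * (1 + be) ^+ N) *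
   (2 * t'^-1) * (eS * expR (- b / A) * expR (- (decay_rate A * residual y theta)) * expR (- E3)))).
  have sn0 : 0 <= s^-1 ^+ n by rewrite exprn_ge0// invr_ge0 sqrtr_ge0.
  have ti0 : 0 <= t^-1 by rewrite invr_ge0 sqrtr_ge0.
  have I0' : 0 <= I^-1 by rewrite invr_ge0 ltW.
  by do 4! [apply: ler_pM; rewrite ?mulr_ge0 ?expR_ge0 ?powR_ge0//].
have -> : (c * (1 + A^-1)) ^+ n * A `^ (- al - 1) * (expR 1 * (1 + be) ^+ N) *
   (2 * t'^-1) * (eS * expR (- b / A) * expR (- (decay_rate A * residual y theta)) * expR (- E3)) =
   c ^+ n * expR 1 * 2 * eS * A `^ (- al - 1) * (t'^-1 * expR (- E3)) *
   ((1 + A^-1) ^+ n * expR (- b / A)) *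
   (expR (- (decay_rate A * residual y theta)) * (1 + be) ^+ N).
  by rewrite exprMn; ring.
set G := t'^-1 * expR (- E3).
have G0 : 0 <= G by rewrite mulr_ge0 ?expR_ge0// invr_ge0 sqrtr_ge0.
set H := c ^+ n * expR 1 * 2 * eS * _ * G.
have H0 : 0 <= H by rewrite /H !mulr_ge0 ?expR_ge0 ?powR_ge0 ?exprn_ge0 ?invr_ge0 ?sqrtr_ge0.
apply: (@le_trans _ _ (H * ((1 + A^-1) ^+ n * expR (- b / A)) *
    (C1 * (1 + A^-1) ^+ (N + n) * cauchy_weight theta))).
  apply: ler_wpM2l; last exact: C1_ge.
  exact: mulr_ge0 H0 (mulr_ge0 (exprn_ge0 _ u0) (expR_ge0 _)).
have -> : H * ((1 + A^-1) ^+ n * expR (- b / A)) *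
    (C1 * (1 + A^-1) ^+ (N + n) * cauchy_weight theta) =
    H * C1 * cauchy_weight theta * ((1 + A^-1) ^+ (n + (N + n)) * expR (- b / A)).
  by rewrite (exprD _ n); ring.
apply: (@le_trans _ _ (H * C1 * cauchy_weight theta * (C2 * expR (- (b / 2) / A)))).
  apply: ler_wpM2l; last exact: C2_ge.
  exact: mulr_ge0 (mulr_ge0 H0 C10) (cauchy_weight_ge0 _).
by rewrite le_eqVlt /H; apply/orP; left; apply/eqP; ring.
Qed.

End diagonal_bound.

(** * The operator of the two-block Gibbs sampler *)

Section posterior_operator.
Context {R : realType} (n : nat).
Variables (y : n.-tuple R) (V a b : R).
Hypotheses (V0 : 0 < V) (a0 : 0 < a) (b0 : 0 < b) (n3 : (3 <= n)%N).
Implicit Types (theta : euclidean R n) (m A : R).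

Local Notation lam := (lebesgue_measure_n n).
Local Notation leb := (@lebesgue_measure R).
Local Notation weight := (theta_weight y V a b).

Lemma measurable_cauchy_weight : measurable_fun setT (@cauchy_weight R n).
Proof.
apply: measurable_prod => i _; apply: (measurableT_comp measurable_inv).
apply: measurable_funD => //; apply: measurable_funX.
exact: (@measurable_tnth _ _ _ i).
Qed.

Lemma integral_cauchy_weight : (\int[lam]_theta (@cauchy_weight R n theta)%:E < +oo)%E.
Proof.
rewrite (@integral_lebesgue_measure_n_prod _ n (fun=> fun x => (1 + x ^+ 2)^-1)).
- have : (\int[leb]_x ((1 + x ^+ 2)^-1)%:E \is a fin_num)%E.
    rewrite ge0_fin_numE ?integral_oneDsqrV_lty// integral_ge0// => x _.
    by rewrite lee_fin invr_ge0 addr_ge0 ?sqr_ge0.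
  by move=> /fineK <-; rewrite prodEFin ltry.
- by move=> i; apply: continuous_measurable_fun; exact: continuous_oneDsqrV.
- by move=> i x; rewrite invr_ge0 addr_ge0 ?sqr_ge0.
Qed.

(** [inverse_gamma_mass] decreases with the scale, so only the Gaussian factor of
    [theta_weight] matters. *)
Lemma theta_weight_le : exists2 C, 0 <= C & forall theta,
  weight theta <= C * cauchy_weight theta.
Proof.
have [C C0 C_ge] := @residual_pow_le R n y.
pose D := Num.sqrt (2 * pi / n%:R) * (n`!%:R * (2 * V) ^+ n * expR (2 * V)^-1).
pose I := inverse_gamma_mass (ig_shape n a) b.
have al1 : 1 <= ig_shape n a := ig_shape_ge1 a0 n3.
have I0 : 0 < I by exact: inverse_gamma_mass_gt0.
have D0 : 0 <= D by rewrite !mulr_ge0 ?sqrtr_ge0 ?exprn_ge0 ?expR_ge0 ?mulr_ge0 ?(ltW V0).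
exists (D * C * I) => [|theta]; first exact: mulr_ge0 (mulr_ge0 D0 C0) (ltW I0).
have q0 := residual_ge0 y theta; set q := residual y theta in q0.
have e_le : expR (- (2 * V)^-1 * q) <=
    n`!%:R * (2 * V) ^+ n * expR (2 * V)^-1 * (C * cauchy_weight theta).
  have q1 : 0 < (1 + q) ^+ n by rewrite exprn_gt0// ltr_pwDl.
  apply: (@le_trans _ _ (n`!%:R * (2 * V) ^+ n * expR (2 * V)^-1 * ((1 + q) ^+ n)^-1)); last first.
    rewrite ler_wpM2l ?C_ge// !mulr_ge0 ?exprn_ge0 ?expR_ge0// mulr_ge0//; exact: ltW.
  have x0 : 0 <= (2 * V)^-1 * (1 + q).
    by rewrite mulr_ge0 ?addr_ge0// invr_ge0 mulr_ge0// ltW.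
  have := exprn_le_expR n x0.
  rewrite exprMn mulrDr mulr1 expRD -ler_pdivlMl ?exprn_gt0 ?invr_gt0 ?mulr_gt0// => h.
  rewrite mulNr expRN ler_pdivlMr// mulrC ler_pdivrMr ?expR_gt0//.
  apply: le_trans h _; rewrite exprVn invrK.
  by rewrite le_eqVlt; apply/orP; left; apply/eqP; ring.
have I_le : inverse_gamma_mass (ig_shape n a) (ig_scale b theta) <= I.
  have be0 := ig_scale_gt0 b0 theta.
  apply: le_Rintegral => //; try exact: integrable_inverse_gamma_fun.
  move=> t /=; rewrite in_itv/= andbT => t0; rewrite ler_wpM2l ?powR_ge0// ler_expR.
  rewrite ler_wpM2r ?invr_ge0 ?(ltW t0)// lerN2 lerDl mulr_ge0//.
  exact: deviation_ge0.
have -> : D * C * I * cauchy_weight theta = Num.sqrt (2 * pi / n%:R) *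
  (n`!%:R * (2 * V) ^+ n * expR (2 * V)^-1 * (C * cauchy_weight theta)) * I.
  by rewrite /D; ring.
apply: ler_pM => //; rewrite ?mulr_ge0 ?sqrtr_ge0 ?expR_ge0//.
  exact/ltW/(inverse_gamma_mass_gt0 al1 (ig_scale_gt0 b0 theta)).
by rewrite ler_wpM2l ?sqrtr_ge0.
Qed.

Lemma measurable_theta_weight : measurable_fun setT weight.
Proof.
apply/measurable_EFinP; rewrite (_ : EFin \o _ = unnormalized_marginal y V a b).
  exact: measurable_unnormalized_marginal.
by apply/funext => theta /=; rewrite unnormalized_marginalE.
Qed.

Lemma posterior_constant_fin : (0 < posterior_constant y V a b < +oo)%E.
Proof.
rewrite /posterior_constant.
under eq_integral do rewrite unnormalized_marginalE//.
have mw : measurable_fun setT (fun theta => (weight theta)%:E).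
  by apply/measurable_EFinP; exact: measurable_theta_weight.
apply/andP; split.
  apply: integral_gt0 => // [theta|]; last exact: lebesgue_measure_n_setT.
  by rewrite lte_fin theta_weight_gt0.
have [C C0 C_ge] := theta_weight_le.
have mcw : measurable_fun setT (fun theta : euclidean R n => (@cauchy_weight R n theta)%:E).
  by apply/measurable_EFinP; exact: measurable_cauchy_weight.
apply: (@le_lt_trans _ _ (\int[lam]_theta (C%:E * (@cauchy_weight R n theta)%:E))%E).
  apply: ge0_le_integral => //.
  - by move=> theta _; rewrite lee_fin ltW// theta_weight_gt0.
  - exact: measurable_funeM.
  - by move=> theta _; rewrite -EFinM lee_fin C_ge.
rewrite ge0_integralZl//; last by move=> theta _; rewrite lee_fin cauchy_weight_ge0.
by rewrite lte_mul_pinfty// ?lee_fin// integral_cauchy_weight.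
Qed.

Definition posterior_mass : R := fine (posterior_constant y V a b).

Lemma posterior_mass_gt0 : 0 < posterior_mass.
Proof. by rewrite fine_gt0// posterior_constant_fin. Qed.

Lemma marginal_posterior_densityE theta :
  marginal_posterior_density y V a b theta = (weight theta / posterior_mass)%:E.
Proof.
by rewrite /marginal_posterior_density unnormalized_marginalE// -EFinM mulrC.
Qed.

Local Notation Z := posterior_mass.

(** With [z = (A, m)], this is the density of the joint posterior of [theta]
    and [z] with respect to the product of its marginals, times the square root
    of the density of the marginal of [z] with respect to Lebesgue measure. *)
Definition joint_kernel theta (z : measurableTypeR R * measurableTypeR R) : R :=
  if 0 < z.1 then
    (Num.sqrt (hyper_weight y V a b z.2 z.1))^-1 * Num.sqrt Z *
    unnormalized_posterior y V a b theta z.2 z.1 * (weight theta)^-1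
  else 0.

Lemma joint_kernel_ge0 theta z : 0 <= joint_kernel theta z.
Proof.
rewrite /joint_kernel; case: ifP => // _.
rewrite !mulr_ge0 ?invr_ge0 ?sqrtr_ge0 ?powR_ge0 ?expR_ge0//.
exact/ltW/theta_weight_gt0.
Qed.

Lemma measurable_joint_kernel : measurable_fun setT
  (fun p : euclidean R n * (measurableTypeR R * measurableTypeR R) =>
    joint_kernel p.1 p.2).
Proof.
pose U : Type := (euclidean R n * (measurableTypeR R * measurableTypeR R))%type.
have mA : measurable_fun setT (fun p : U => p.2.1 : R).
  exact: (measurableT_comp measurable_fst measurable_snd).
have mm : measurable_fun setT (fun p : U => p.2.2 : R).
  exact: (measurableT_comp measurable_snd measurable_snd).
have mt i : measurable_fun setT (fun p : U => tnth p.1 i : R).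
  exact: (measurableT_comp (measurable_tnth i) measurable_fst).
have minv (f : U -> R) : measurable_fun setT f -> measurable_fun setT (fun p => (f p)^-1).
  by move=> mf; exact: measurableT_comp measurable_inv mf.
have mexp (f : U -> R) : measurable_fun setT f -> measurable_fun setT (fun p => expR (f p)).
  by move=> mf; exact: measurableT_comp (@measurable_expR R) mf.
have mpow (f : U -> R) c : measurable_fun setT f -> measurable_fun setT (fun p => f p `^ c).
  by move=> mf; exact: measurableT_comp (measurable_powR c) mf.
have msqrt (f : U -> R) : measurable_fun setT f -> measurable_fun setT (fun p => Num.sqrt (f p)).
  move=> mf; apply: measurableT_comp mf.
  by apply: continuous_measurable_fun; exact: sqrt_continuous.
have msq (I : Type) (r : seq I) (f g : I -> U -> R) : (forall i, measurable_fun setT (f i)) ->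
    (forall i, measurable_fun setT (g i)) ->
    measurable_fun setT (fun p => \sum_(i <- r) (f i p - g i p) ^+ 2).
  move=> mf mg; apply: measurable_sum => i; apply: measurable_funX.
  exact: measurable_funB.
apply: measurable_fun_ifT => //; first exact: measurable_fun_ltr.
apply: measurable_funM; first apply: measurable_funM; first apply: measurable_funM => //.
- apply: (minv _); apply: (msqrt _); rewrite /hyper_weight.
  apply: measurable_funM; first apply: measurable_funM; first apply: measurable_funM.
  + exact: (mpow _ _ mA).
  + by apply: (mexp _); apply: measurable_funM => //; exact: (minv _).
  + apply: (mexp _); apply: measurable_funM; last exact: (msq _).
    apply: measurableT_comp => //; apply: (minv _); apply: measurable_funM => //.
    exact: measurable_funD.
  + apply: measurable_funX; apply: (msqrt _); apply: measurable_funM => //.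
    apply: measurable_funM; first exact: measurable_funM.
    by apply: (minv _); exact: measurable_funD.
- rewrite /unnormalized_posterior.
  apply: measurable_funM; first apply: measurable_funM.
  + exact: (mpow _ _ mA).
  + by apply: (mexp _); apply: measurable_funM => //; exact: (minv _).
  + apply: (mexp _); apply: measurable_funB; apply: measurable_funM => //; try exact: (msq _).
    by apply: measurableT_comp => //; apply: (minv _); exact: measurable_funM.
- apply: (minv _); exact: measurableT_comp measurable_theta_weight measurable_fst.
Qed.

(** Detailed balance: the left-hand side is symmetric in [theta] and [theta'] up
    to the factor [weight theta' / Z], the density of [theta']. *)
Lemma joint_kernel_mul theta' theta A m : 0 < A ->
  weight theta' / Z * (joint_kernel theta' (A, m) * joint_kernel theta (A, m)) =
  cond_theta y V m A theta' * cond_mu_A a b theta m A.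
Proof.
move=> A0; rewrite /joint_kernel /= A0.
have h0 := hyper_weight_gt0 y a b V0 m A0.
have Z0 := posterior_mass_gt0.
have t0 := theta_weight_gt0 y V a0 b0 n3 theta.
have t0' := theta_weight_gt0 y V a0 b0 n3 theta'.
rewrite (posterior_cond_theta y a b V0 theta' m A0).
rewrite [unnormalized_posterior _ _ _ _ theta _ _]posterior_cond_mu_A//.
set h := hyper_weight y V a b m A in h0 *; set ct := cond_theta _ _ _ _ _.
set cm := cond_mu_A _ _ _ _ _.
have hE : h = Num.sqrt h ^+ 2 by rewrite sqr_sqrtr// ltW.
have ZE : Z = Num.sqrt Z ^+ 2 by rewrite sqr_sqrtr// ltW.
have s0 : 0 < Num.sqrt h by rewrite sqrtr_gt0.
have r0 : 0 < Num.sqrt Z by rewrite sqrtr_gt0.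
(* With [h] and [Z] as squares, only their square roots occur. *)
move: ct cm (Num.sqrt h) hE s0 (Num.sqrt Z) ZE r0 => ct cm s -> s0 r ZE r0.
move: (posterior_mass) (weight theta) (weight theta') t0 t0' ZE => c w w' w0 w'0 ->.
by field; rewrite !gt_eqF.
Qed.

Local Notation nu := (product_sfm leb leb).

Lemma k2_joint_kernel theta' theta :
  k2 y V a b theta' theta =
  (HS_square nu joint_kernel theta' theta * (weight theta' / Z)%:E)%E.
Proof.
have msec t : measurable_fun setT (joint_kernel t).
  exact: (measurableT_comp measurable_joint_kernel (@pair1_measurable _ _ _ _ t)).
have w0 : 0 <= weight theta' / Z.
  by rewrite divr_ge0 ?(ltW posterior_mass_gt0) ?(ltW (theta_weight_gt0 y V a0 b0 n3 theta')).
rewrite /HS_square muleC -ge0_integralZl//; last 2 first.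
- by apply/measurable_EFinP; exact: measurable_funM.
- by move=> z _; rewrite lee_fin mulr_ge0// joint_kernel_ge0.
rewrite fubini_tonelli1//; last 2 first.
- by apply/measurable_funeM/measurable_EFinP; exact: measurable_funM.
- by move=> z; rewrite mule_ge0// lee_fin mulr_ge0// joint_kernel_ge0.
rewrite /k2 integral_mkcond; apply: eq_integral => A _.
rewrite patchE mem_setE in_itv/= andbT; case: ifPn => A0.
  apply: eq_integral => m _; rewrite -EFinM; congr EFin.
  by rewrite joint_kernel_mul.
rewrite /fubini_F integral0_eq// => m _; rewrite /joint_kernel/=.
by rewrite (negbTE A0) mul0r mule0.
Qed.

Lemma measurable_joint_kernel_section theta : measurable_fun setT (joint_kernel theta).
Proof.
exact: (measurableT_comp measurable_joint_kernel (@pair1_measurable _ _ _ _ theta)).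
Qed.

Lemma k2_diagonal_le : exists2 C, 0 <= C & forall theta,
  (k2 y V a b theta theta <= (C * cauchy_weight theta)%:E)%E.
Proof.
have al1 : 1 <= ig_shape n a := ig_shape_ge1 a0 n3.
have b20 : 0 < b / 2 by rewrite divr_gt0.
have [C C0 C_ge] := diagonal_density_le y V0 a0 b0 n3.
pose I := inverse_gamma_mass (ig_shape n a) (b / 2).
have I0 : 0 <= I by exact/ltW/inverse_gamma_mass_gt0.
exists (C * I) => [|theta]; first exact: mulr_ge0.
have cw0 : 0 <= C * cauchy_weight theta by rewrite mulr_ge0// cauchy_weight_ge0.
have w0 : 0 <= weight theta / Z.
  by rewrite divr_ge0 ?(ltW posterior_mass_gt0) ?(ltW (theta_weight_gt0 y V a0 b0 n3 theta)).
have mh : measurable_fun setT (fun z =>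
    ((weight theta / Z)%:E * (joint_kernel theta z * joint_kernel theta z)%:E)%E).
  apply/measurable_funeM/measurable_EFinP.
  by apply: measurable_funM; exact: measurable_joint_kernel_section.
have h0 z : (0 <= (weight theta / Z)%:E * (joint_kernel theta z * joint_kernel theta z)%:E)%E.
  by rewrite mule_ge0// lee_fin mulr_ge0// joint_kernel_ge0.
have mig : measurable_fun setT (fun A : R => (inverse_gamma_fun (ig_shape n a) (b / 2) A)%:E).
  by apply/measurable_EFinP; exact: measurable_inverse_gamma_fun.
have mig' : measurable_fun setT ((fun A : measurableTypeR R =>
    (inverse_gamma_fun (ig_shape n a) (b / 2) A)%:E) \_ `]0, +oo[%classic).
  by apply/(measurable_restrictT _ _).1 => //; exact: measurable_funTS.
have ig0 (A : R) : (0 <= ((fun A : measurableTypeR R =>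
    (inverse_gamma_fun (ig_shape n a) (b / 2) A)%:E) \_ `]0%R, +oo[%classic) A)%E.
  by rewrite patchE; case: ifP => // _; rewrite lee_fin inverse_gamma_fun_ge0.
rewrite k2_joint_kernel /HS_square muleC -ge0_integralZl//; last 2 first.
- apply/measurable_EFinP.
  by apply: measurable_funM; exact: measurable_joint_kernel_section.
- by move=> z _; rewrite lee_fin mulr_ge0// joint_kernel_ge0.
rewrite fubini_tonelli1//.
apply: (@le_trans _ _ (\int[leb]_A ((C * cauchy_weight theta)%:E *
    ((fun A => (inverse_gamma_fun (ig_shape n a) (b / 2) A)%:E) \_ `]0%R, +oo[%classic) A))%E);
    last first.
  rewrite ge0_integralZl// -integral_mkcond inverse_gamma_massE// -EFinM.
  by rewrite lee_fin mulrAC.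
apply: ge0_le_integral => //.
- by move=> A _; apply: integral_ge0 => m _; exact: h0.
- exact: measurable_fun_fubini_tonelli_F.
- exact: measurable_funeM.
move=> A _; rewrite /fubini_F patchE mem_setE in_itv/= andbT; case: ifPn => A0; last first.
  rewrite mule0 integral0_eq// => m _.
  by rewrite /joint_kernel/= (negbTE A0) mul0r mule0.
rewrite -EFinM.
apply: (@le_trans _ _ (\int[leb]_m (
    (C * cauchy_weight theta * inverse_gamma_fun (ig_shape n a) (b / 2) A)%:E *
    (normal_var_pdf (tuple_mean theta) (2 * A / n%:R) m)%:E))%E); last first.
  rewrite ge0_integralZl//.
  - by rewrite integral_normal_pdf mule1.
  - by apply/measurable_EFinP; exact: measurable_normal_pdf.
  - by move=> m _; rewrite lee_fin normal_pdf_ge0.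
  - by rewrite lee_fin mulr_ge0// inverse_gamma_fun_ge0.
apply: ge0_le_integral => //.
- exact: (measurableT_comp mh (@pair1_measurable _ _ _ _ A)).
- by apply/measurable_funeM/measurable_EFinP; exact: measurable_normal_pdf.
- by move=> m _; rewrite -!EFinM lee_fin joint_kernel_mul// C_ge.
Qed.

Local Notation mu := (marginal_posterior y V a b).

Lemma marginal_posterior_fin : fin_num_fun mu.
Proof.
move=> A mA; rewrite ge0_fin_numE//; apply: (@le_lt_trans _ _ (mu setT)).
  by apply: le_measure; rewrite ?inE.
have -> : mu setT = (\int[lam]_theta (Z^-1%:E * (weight theta)%:E))%E.
  by apply: eq_integral => theta _; rewrite marginal_posterior_densityE mulrC EFinM.
have Z0 : 0 <= Z^-1 by rewrite invr_ge0 ltW ?posterior_mass_gt0.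
rewrite ge0_integralZl//; last 2 first.
- by apply/measurable_EFinP; exact: measurable_theta_weight.
- by move=> theta _; rewrite lee_fin ltW// theta_weight_gt0.
rewrite lte_mul_pinfty//.
have /andP[_] := posterior_constant_fin; congr (_ < _)%E.
by apply: eq_integral => theta _; rewrite unnormalized_marginalE.
Qed.

Lemma integral_marginal_posterior (mu' : {measure set (euclidean R n) -> \bar R})
    (f : euclidean R n -> \bar R) :
  mu' = mu :> (set _ -> \bar R) -> measurable_fun setT f ->
  (\int[mu']_theta f theta = \int[lam]_theta (f theta * (weight theta / Z)%:E))%E.
Proof.
move=> mu'E mf; rewrite (eq_measure_integral mu)//; last first.
  by move=> A _ _; rewrite mu'E.
rewrite /marginal_posterior integral_density//.
  by apply: eq_integral => theta _; rewrite marginal_posterior_densityE.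
by move=> theta; rewrite marginal_posterior_densityE.
Qed.

(** The squared Hilbert-Schmidt norm is the integral of [k2] over the diagonal.
    The posterior enters as a sigma-finite measure [mu'] with the same values as
    [mu]. *)
Lemma HS_joint_kernel
    (mu' : {sigma_finite_measure set (euclidean R n) -> \bar R}) :
  mu' = mu :> (set _ -> \bar R) -> HS_kernel mu' nu joint_kernel.
Proof.
move=> mu'E; split; first exact: measurable_joint_kernel.
have mphi2 : measurable_fun setT (fun p => (joint_kernel p.1 p.2 ^+ 2)%:E).
  by apply/measurable_EFinP/measurable_funX; exact: measurable_joint_kernel.
have phi2_ge0 (p : euclidean R n * (measurableTypeR R * measurableTypeR R)) :
    (0 <= (joint_kernel p.1 p.2 ^+ 2)%:E)%E by rewrite lee_fin sqr_ge0.
rewrite integral_marginal_posterior//; last first.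
  exact: (measurable_fun_fubini_tonelli_F _ mphi2 phi2_ge0).
have -> : (\int[lam]_theta ((\int[nu]_z (joint_kernel theta z ^+ 2)%:E) *
    (weight theta / Z)%:E) = \int[lam]_theta k2 y V a b theta theta)%E.
  by apply: eq_integral => theta _; rewrite k2_joint_kernel.
have [C C0 C_ge] := k2_diagonal_le.
have mcw : measurable_fun setT (fun theta : euclidean R n => (@cauchy_weight R n theta)%:E).
  by apply/measurable_EFinP; exact: measurable_cauchy_weight.
apply: (@le_lt_trans _ _ (\int[lam]_theta (C%:E * (@cauchy_weight R n theta)%:E))%E).
  apply: ge0_le_integral => //.
  - move=> theta _; apply: integral_ge0 => A _; apply: integral_ge0 => m _.
    by rewrite lee_fin mulr_ge0 ?cond_theta_ge0 ?cond_mu_A_ge0.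
  - under eq_fun do rewrite k2_joint_kernel.
    apply: emeasurable_funM.
      have := measurable_fun_fubini_tonelli_F _ mphi2 phi2_ge0 (m2 := nu).
      by congr measurable_fun; apply/funext => theta; rewrite /HS_square/=;
        apply: eq_integral => z _; rewrite expr2.
    apply/measurable_EFinP; apply: measurable_funM => //.
    exact: measurable_theta_weight.
  - exact: measurable_funeM.
rewrite ge0_integralZl//; last by move=> theta _; rewrite lee_fin cauchy_weight_ge0.
by rewrite lte_mul_pinfty// ?lee_fin// integral_cauchy_weight.
Qed.

Lemma kernel_operator_k2 (mu' : {sigma_finite_measure set (euclidean R n) -> \bar R})
    (f : euclidean R n -> R) :
  mu' = mu :> (set _ -> \bar R) -> measurable_fun setT f ->
  kernel_operator lam (k2 y V a b) f = kernel_operator mu' (HS_square nu joint_kernel) f.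
Proof.
move=> mu'E mf; apply/funext => theta; congr fine.
rewrite [RHS]integral_marginal_posterior//; last first.
  exact: (measurable_HS_square_section (HS_joint_kernel mu'E) joint_kernel_ge0).
by apply: eq_integral => theta' _; rewrite k2_joint_kernel muleA.
Qed.

End posterior_operator.

Section sigma_finite_copy.
Context d (T : measurableType d) (R : realType).
Variables (mu : {measure set T -> \bar R}) (sf : sigma_finite setT mu).

(** An alias of [mu] that carries the structure of a sigma-finite measure. *)
Definition sigma_finite_copy of sigma_finite setT mu : set T -> \bar R := mu.

HB.instance Definition _ := Measure.on (sigma_finite_copy sf).

HB.instance Definition _ :=
  Measure_isSigmaFinite.Build _ _ _ (sigma_finite_copy sf) sf.

End sigma_finite_copy.

Theorem proposition4 (R : realType) (n : nat) (y : n.-tuple R) (V a b : R)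
    (V_gt0 : 0 < V) (a_gt0 : 0 < a) (b_gt0 : 0 < b) (n_ge3 : (3 <= n)%N) :
  kernel_operator_defined (lebesgue_measure_n n) (k2 y V a b)
    (marginal_posterior y V a b) /\
  trace_class (marginal_posterior y V a b)
    (kernel_operator (lebesgue_measure_n n) (k2 y V a b)).
Proof.
have sf : sigma_finite setT (marginal_posterior y V a b).
  apply: fin_num_fun_sigma_finite; first by rewrite measure0.
  exact: marginal_posterior_fin.
pose mu' := [the {sigma_finite_measure set _ -> \bar R} of sigma_finite_copy sf].
have mu'E : mu' = marginal_posterior y V a b :> (set _ -> \bar R) by [].
have HS := HS_joint_kernel V_gt0 a_gt0 b_gt0 n_ge3 mu'E.
have ge0 := joint_kernel_ge0 y V a_gt0 b_gt0 n_ge3.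
have KE f : f \in Lfun mu' 2%:E -> kernel_operator (lebesgue_measure_n n) (k2 y V a b) f =
    kernel_operator mu' (HS_square (product_sfm lebesgue_measure lebesgue_measure)
      (joint_kernel y V a b)) f.
  by move=> /Lfun_measurable mf; exact: kernel_operator_k2.
split; last exact: HS_square_trace_class HS ge0 _ KE.
move=> f fL; apply: filterS (HS_square_defined HS ge0 fL) => theta fk.
have mfk := measurable_int _ fk.
have dens_fin t : marginal_posterior_density y V a b t \is a fin_num.
  by rewrite marginal_posterior_densityE.
have := integrable_density dens_fin mfk fk.
congr (_.-integrable _ _); apply/funext => t.
by rewrite k2_joint_kernel// marginal_posterior_densityE// muleA.
Qed.
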